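(* Let $I$ be an ideal and let $\xi\in \mathrm{c}_{\mathrm{o}}^*$. Then the following conditions are equivalent. (i) $\xi\in\Sigma(I^-)$. (ii) $\xi\prec\eta$ for some $\eta\in\Sigma(I)$. (ii$'$) $\xi\preccurlyeq\eta$ for some $\eta\in\Sigma(I)$. (iii) $\xi=P\eta$ for some $\eta\in\Sigma(I)$ and some substochastic matrix $P$. (iii$'$) $\xi=Q\eta$ for some $\eta\in\Sigma(I)$ and some orthostochastic matrix $Q$. (iv) $\operatorname{diag}\xi=E(L\operatorname{diag}\eta\,L^* )$ for some $\eta\in\Sigma(I)$ and some contraction $L$. (iv$'$) $\operatorname{diag}\xi=E(U\operatorname{diag}\eta\,U^* )$ for some $\eta\in\Sigma(I)$ and some orthogonal matrix $U$. If $I\supset\mathscr L_1$, then these conditions are also equivalent to: (ii$''$) $\xi\prec_b\eta$ for some $\eta\in\Sigma(I)$. (iii$''$) $\xi=Q\eta$ for some $\eta\in\Sigma(I)$ and some block orthostochastic matrix $Q$. (iv$''$) $\operatorname{diag}\xi=E(U\operatorname{diag}\eta\,U^* )$ for some $\eta\in\Sigma(I)$ and some matrix $U$ that is a direct sum of finite orthogonal matrices.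
   Context: $\mathrm{c}_{\mathrm{o}}^*$ denotes the cone of nonnegative monotone nonincreasing sequences converging to $0$ (not a dual space). For $\xi,\eta\in \mathrm{c}_{\mathrm{o}}^*$: $\xi\prec\eta$ means $\sum_{j=1}^n\xi_j\le\sum_{j=1}^n\eta_j$ for every $n\in\mathbb N$; $\xi\preccurlyeq\eta$ means $\xi\prec\eta$ and $\liminf_n\sum_{j=1}^n(\eta_j-\xi_j)=0$; $\xi\prec_b\eta$ means $\xi\prec\eta$ and $\sum_{j=1}^{n_k}\xi_j=\sum_{j=1}^{n_k}\eta_j$ for some sequence $\mathbb N\ni n_k\uparrow\infty$. $H$ is a complex separable infinite-dimensional Hilbert space with a fixed orthonormal basis; infinite matrices are identified with operators. $\operatorname{diag}\rho$ is the diagonal operator with diagonal $\rho$, and $E(A)$ is the diagonal operator with the same main diagonal as $A\in B(H)$. An orthogonal matrix is a unitary matrix with real entries. A matrix with nonnegative entries is substochastic if all row and column sums are at most $1$. $Q$ is orthostochastic (resp. block orthostochastic) if $Q_{ij}=(U_{ij})^2$ for all $i,j$ with $U$ an orthogonal matrix (resp. a direct sum of finite orthogonal matrices). $P\eta:=\langle\sum_jP_{ij}\eta_j\rangle_i$. An ideal is a two-sided ideal of $B(H)$ contained in the compact operators. $s(X)$ is the nonincreasing sequence of singular numbers of a compact operator $X$ (with multiplicity, with infinitely many zeros added if $X$ has finite rank). The characteristic set of $I$ is $\Sigma(I):=\{s(X)\mid X\in I\}\subset \mathrm{c}_{\mathrm{o}}^*$; it determines $I$ (Calkin). $\mathscr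 L_1$ is the trace class. For $\xi\in \mathrm{c}_{\mathrm{o}}^*$, $\xi_a:=\langle\frac1n\sum_{j=1}^n\xi_j\rangle$. The ideals ${}_aI$ and $I_a$ have characteristic sets $\Sigma({}_aI)=\{\xi\in \mathrm{c}_{\mathrm{o}}^*\mid\xi_a\in\Sigma(I)\}$ and $\Sigma(I_a)=\{\xi\in \mathrm{c}_{\mathrm{o}}^*\mid\xi=O(\eta_a)\text{ for some }\eta\in\Sigma(I)\}$, where $\xi=O(\zeta)$ means $\xi_n\le M\zeta_n$ for some $M>0$ and all $n$. The am-closure of $I$ is $I^-:={}_a(I_a)$. *)

(* Defs.v *)
From mathcomp Require Import all_boot all_order all_algebra.
From mathcomp Require Import sesquilinear complex.
From mathcomp Require Import all_classical all_reals all_analysis.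

Set Implicit Arguments.
Unset Strict Implicit.
Unset Printing Implicit Defensive.
Import Order.TTheory GRing.Theory Num.Theory.
Import numFieldNormedType.Exports.
Local Open Scope classical_set_scope.
Local Open Scope ring_scope.

(* Sequences are indexed from 0, so that the n-th partial sum xi_1 + ... + xi_n
   is [series xi n] and xi_a is [arithmetic_mean xi]. *)
Section Sequences.
Variable R : realType.
Implicit Types (xi eta : R^nat) (P : nat -> nat -> R).

Definition c0star xi : Prop :=
  [/\ forall n, 0 <= xi n, nonincreasing_seq xi & xi @ \oo --> (0 : R)].

Definition majorized xi eta : Prop :=
  forall n, series xi n <= series eta n.

(* The liminf is taken in the extended reals: the partial sums of eta - xi may
   tend to +oo. *)
Definition strongly_majorized xi eta : Prop :=
  majorized xi eta /\
  limn_einf (fun n => (series eta n - series xi n)%:E) = 0%E.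

Definition block_majorized xi eta : Prop :=
  majorized xi eta /\
  exists n : nat -> nat, {homo n : i j / (i < j)%N} /\
    forall k, series xi (n k) = series eta (n k).

Definition seq_bigO xi zeta : Prop :=
  exists2 M : R, 0 < M & forall n, xi n <= M * zeta n.

Definition substochastic P : Prop :=
  [/\ forall i j, 0 <= P i j,
      forall i, (\sum_(0 <= j <oo) (P i j)%:E <= 1)%E &
      forall j, (\sum_(0 <= i <oo) (P i j)%:E <= 1)%E].

Definition mxact P eta : R^nat :=
  fun i => limn (series (fun j => P i j * eta j)).

End Sequences.

Section Operators.
Variables (R : realType) (H : completeNormedModType R[i]).
Variable dot : {dot H for Num.conj}.
Implicit Types (A B L U X : H -> H) (f : nat -> H) (I : set (H -> H)).

Definition hilbert_norm : Prop := forall x : H, dot x x = `|x| ^+ 2.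

Definition orthonormal_seq f : Prop :=
  forall i j, dot (f i) (f j) = (i == j)%:R.

Definition orthonormal_basis f : Prop :=
  orthonormal_seq f /\ forall x, (forall n, dot x (f n) = 0) -> x = 0.

Definition bounded_op A : Prop := linear A /\ continuous A.

Definition compact_op A : Prop :=
  bounded_op A /\ precompact (A @` [set x | `|x| <= 1]).

(* The adjoint of a bounded operator exists and is unique; the default value is
   never used for such operators. *)
Definition adjoint A : H -> H :=
  xget (fun _ : H => (0 : H))
    [set B : H -> H | forall x y, dot (A x) y = dot x (B y)].

Definition contraction_op L : Prop :=
  bounded_op L /\ forall x, `|L x| <= `|x|.

Definition unitary_op U : Prop :=
  [/\ bounded_op U, adjoint U \o U = id & U \o adjoint U = id].

(* An ideal is a possibly zero two-sided ideal of B(H) inside the compact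
   operators; closure under scalars follows from [ideal_mul]. *)
Record operator_ideal I : Prop := OperatorIdeal {
  ideal_compact : I `<=` compact_op;
  ideal_zero : I (fun _ => 0);
  ideal_add : forall X Y, I X -> I Y -> I (X \+ Y);
  ideal_mul : forall A X B,
    bounded_op A -> I X -> bounded_op B -> I (A \o X \o B) }.

(* s lists the square roots of the eigenvalues of X^* X, in nonincreasing order
   and with multiplicity: the f n are orthonormal eigenvectors, and X vanishes
   on the orthogonal complement of their span. If X has infinite rank then all
   s n are positive; if X has finite rank then s ends with zeros, the
   corresponding f n being in the kernel of X. *)
Definition singular_numbers X (s : R^nat) : Prop :=
  c0star s /\
  exists f : nat -> H,
    [/\ orthonormal_seq f,
        forall n, adjoint X (X (f n)) = ((s n) ^+ 2)%:C%C *: f n &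
        forall x, (forall n, dot x (f n) = 0) -> X x = 0].

Definition charset I : set R^nat :=
  [set s | exists2 X, I X & singular_numbers X s].

(* The ideal with a given characteristic set. *)
Definition ideal_of_charset (S : set R^nat) : set (H -> H) :=
  [set X | compact_op X /\ exists2 s, S s & singular_numbers X s].

Definition trace_class : set (H -> H) :=
  ideal_of_charset [set s | cvgn (series s)].

Definition pre_am_ideal I : set (H -> H) :=
  ideal_of_charset [set xi | c0star xi /\ charset I (arithmetic_mean xi)].

Definition am_ideal I : set (H -> H) :=
  ideal_of_charset [set xi | c0star xi /\
    exists2 eta, charset I eta & seq_bigO xi (arithmetic_mean eta)].

Definition am_closure I : set (H -> H) := pre_am_ideal (am_ideal I).

Section Matrices.
Variable e : nat -> H. (* the fixed orthonormal basis *)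

Definition entry A i j : R[i] := dot (A (e j)) (e i).

Definition diag_op (rho : nat -> R[i]) : H -> H :=
  fun x => limn (series (fun n => (rho n * dot x (e n)) *: e n)).

Definition diag_seq (rho : R^nat) : H -> H := diag_op (fun n => (rho n)%:C%C).

Definition diag_part A : H -> H := diag_op (fun n => entry A n n).

Definition orthogonal_op U : Prop :=
  unitary_op U /\ forall i j, entry U i j \is Num.real.

(* The matrix of U is block diagonal with consecutive finite orthogonal blocks
   B k of positive size m k; block k starts at index m 0 + ... + m k.-1. *)
Definition block_orthogonal_op U : Prop :=
  bounded_op U /\
  exists (m : nat -> nat) (B : forall k, 'M[R]_(m k)),
    let off k := (\sum_(l < k) m l)%N in
    [/\ forall k, (0 < m k)%N,
        forall k, B k *m (B k)^T = 1%:M,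
        forall k (a b : 'I_(m k)),
          entry U (off k + a) (off k + b) = (B k a b)%:C%C &
        forall k l (a : 'I_(m k)) (b : 'I_(m l)), k != l ->
          entry U (off k + a) (off l + b) = 0].

Definition orthostochastic (Q : nat -> nat -> R) : Prop :=
  exists2 U, orthogonal_op U & forall i j, (Q i j)%:C%C = entry U i j ^+ 2.

Definition block_orthostochastic (Q : nat -> nat -> R) : Prop :=
  exists2 U, block_orthogonal_op U &
    forall i j, (Q i j)%:C%C = entry U i j ^+ 2.

End Matrices.
End Operators.

(* Main.v *)
(* Everything is reduced to diagonal operators: a sequence belongs to the
   characteristic set of I iff its diagonal operator belongs to I, and singular
   numbers are unique by the min-max principle, so (i) says that the means of xi
   are dominated by those of a multiple of some eta, which is (ii).

   For the passage from majorization to unitaries, suppose first that the sum of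
   xi diverges. Then 2 eta - xi has partial sums tending to infinity, and capping
   the tail of 2 eta at the smallest level preserving majorization produces an
   equality of partial sums; iterating gives zeta <= 2 eta with infinitely many
   equalities of partial sums with xi. Horn's theorem on each of the resulting
   finite blocks yields a block orthogonal matrix. If the sum S of xi is finite
   and positive, eta can be replaced by (S, 0, 0, ...), and a reflection sending
   e_0 to the unit vector with coordinates sqrt (xi_i / S) does the job. *)

(* Without the factor 2 the gap between the partial sums of [eta] and [xi] could tend to 0 without
   vanishing, and lowering a cap would not create an equality. After doubling the gap is unbounded.
   A positive cap changes only finitely many entries of a null sequence, so the gap stays unbounded
   and the capping can be repeated; divergence of [xi] is what keeps the cap positive. Sigma(I)
   absorbs the factor, being closed under domination up to a constant. For summable [xi], equality
   at infinitely many indices may be out of reach: if I consists of finite rank operators, it forces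
   [xi] to be finitely supported. Hence the two groups of conditions: the reflection, which may mix
   infinitely many coordinates, serves every nonzero ideal, whereas the block conditions use [xi]
   itself as a trace class witness. The way back to majorization is common to all matrix conditions:
   the squared moduli of the entries form a substochastic matrix. *)
Require Import Defs.
From mathcomp Require Import all_boot all_order all_algebra.
From mathcomp Require Import sesquilinear complex.
From mathcomp Require Import all_classical all_reals all_analysis.
From mathcomp Require Import ring lra zify.

Set Implicit Arguments.
Unset Strict Implicit.
Unset Printing Implicit Defensive.
Import Order.TTheory GRing.Theory Num.Theory.
Import numFieldNormedType.Exports.
Local Open Scope classical_set_scope.
Local Open Scope ring_scope.

(** * Capping a sequence until its partial sums meet those of [xi] *)

Section RealSequences.
Variable R : realType.
Implicit Types (x y z xi eta : R^nat).

Lemma seriesSr x n : series x n.+1 = series x n + x n.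
Proof. by rewrite /series /= big_nat_recr. Qed.

Lemma series0n x : series x 0 = 0.
Proof. by rewrite /series /= big_geq. Qed.

Lemma eq_series_lt x y n : (forall j, (j < n)%N -> x j = y j) ->
  series x n = series y n.
Proof. by move=> h; rewrite /series /=; apply: eq_big_nat => j /andP[_]; exact: h. Qed.

Lemma series_mono x m n : (forall j, 0 <= x j) -> (m <= n)%N ->
  series x m <= series x n.
Proof.
move=> x0 /subnKC <-; elim: (n - m)%N => [|k IH]; first by rewrite addn0.
by rewrite addnS seriesSr (le_trans IH)// lerDl.
Qed.

Lemma series_ge0 x n : (forall j, 0 <= x j) -> 0 <= series x n.
Proof. by move=> x0; rewrite /series /= sumr_ge0. Qed.

Lemma series_le x y n : (forall j, x j <= y j) -> series x n <= series y n.
Proof. by move=> h; rewrite /series /= ler_sum. Qed.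

Lemma series_finite_support x p n : (forall j, 0 <= x j) ->
  (forall j, (p <= j)%N -> x j = 0) -> series x n <= series x p.
Proof.
move=> x0 xp; have [np|/ltnW pn] := leqP n p; first exact: series_mono.
rewrite -(subnKC pn); elim: (n - p)%N => [|k IH]; first by rewrite addn0.
by rewrite addnS seriesSr xp ?leq_addr// addr0.
Qed.

Lemma series_sub x y n : series x n - series y n = series (fun j => x j - y j) n.
Proof. by rewrite /series /= -sumrB. Qed.

Lemma series_const (a : R) n : series (fun=> a) n = a * n%:R.
Proof. by rewrite /series /= big_const_nat subn0 iter_addr_0 mulr_natr. Qed.

Lemma divergent_unbounded x A : (forall j, 0 <= x j) -> ~ cvgn (series x) ->
  exists n, A < series x n.
Proof.
move=> x0 nc; apply: contrapT => H; apply: nc.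
apply: nondecreasing_is_cvgn.
  by apply/nondecreasing_seqP => n; rewrite seriesSr lerDl.
exists A => _ [n _ <-]; rewrite leNgt; apply/negP => h; apply: H; by exists n.
Qed.

Lemma c0star_small x (e : R) : c0star x -> 0 < e ->
  exists p, forall j, (p <= j)%N -> x j <= e.
Proof.
move=> [x0 _ xc] e0; have /cvgrPdist_le /(_ _ e0) [p _ hp] := xc.
exists p => j pj; have := hp j pj; rewrite sub0r normrN ger0_norm //.
Qed.

Lemma minr_diff_le (a c d q : R) : 0 <= q -> d <= c + q ->
  Num.min a d - Num.min a c <= q.
Proof. by move=> ? ?; case: (leP a d) => ?; case: (leP a c) => ?; lra. Qed.

(** The first m entries are exempt, so equalities of partial sums already obtained up to m survive
    later cappings. *)
Definition capped (m : nat) (c : R) z : R^nat :=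
  fun j => if (j < m)%N then z j else Num.min (z j) c.

Lemma capped_le m c z j : capped m c z j <= z j.
Proof. by rewrite /capped; case: ifP => // _; rewrite ge_min lexx. Qed.

Lemma capped_c0star m c z : 0 <= c -> c0star z -> c0star (capped m c z).
Proof.
move=> c0 [z0 zd zc]; have cp0 n : 0 <= capped m c z n.
  by rewrite /capped; case: ifP => // _; rewrite le_min z0.
split => //.
- apply/nonincreasing_seqP => n.
  have zz : z n.+1 <= z n by apply: zd.
  rewrite /capped; case: ltnP => h1; case: ltnP => h2 //; first by lia.
    by rewrite ge_min zz.
  by rewrite le_min !ge_min zz lexx orbT.
- apply: (squeeze_cvgr _ (cvg_cst 0) zc).
  by near=> n; rewrite cp0 capped_le.
Unshelve. all: by end_near. Qed.

(** Invariant of the iteration. Since the gap tends to infinity, it can be small at finitely many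
    indices only; a gap that never vanishes is then bounded below by a positive constant. *)
Definition dominates xi z : Prop :=
  [/\ c0star z, majorized xi z &
      forall A : R, exists N, forall n, (N <= n)%N -> A <= series z n - series xi n].

Lemma positive_lower_bound (D : nat -> R) m N :
  (forall n, (m <= n)%N -> 0 < D n) ->
  exists2 d : R, 0 < d & forall n, (m <= n < N)%N -> d <= D n.
Proof.
move=> Dp; elim: N => [|N [d d0 hd]]; first by exists 1 => // n; lia.
have [mN|Nm] := leqP m N.
  exists (Num.min d (D N)) => [|n /andP[mn]]; first by rewrite lt_min d0 Dp.
  rewrite ltnS leq_eqVlt => /orP[/eqP ->|nN]; first by rewrite ge_min lexx orbT.
  by rewrite ge_min hd// mn.
by exists d => // n; lia.
Qed.

(** The cap c is the infimum of those preserving majorization. If the gap vanished at no index from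
    m on, it would be bounded below there and c could be lowered a little further. *)
Lemma capped_touch xi z m : (forall j, 0 <= xi j) -> ~ cvgn (series xi) ->
  dominates xi z ->
  exists z' n, [/\ dominates xi z', (m <= n)%N,
    forall j, (j < m)%N -> z' j = z j, forall j, z' j <= z j &
    series xi n = series z' n].
Proof.
move=> xi0 xid [zc zm zD].
have [z0 zd _] := zc.
pose C := [set c : R | 0 <= c /\ majorized xi (capped m c z)].
have Cn0 : C (z 0%N).
  split => //= n; rewrite (_ : capped m (z 0%N) z = z) //.
  apply/funext => j; rewrite /capped; case: ifP => // _.
  by rewrite min_l //; apply: zd.
have Cinf : has_inf C by split; [exists (z 0%N) | exists 0 => c [] ].
pose c := inf C.
have c0 : 0 <= c by apply: lb_le_inf; [exists (z 0%N) | move=> d []].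
(* The infimum is itself admissible: for fixed n, raising the cap by e / (n + 1) raises the n-th
   partial sum by at most e. *)
have Cc : majorized xi (capped m c z).
  move=> n; apply/ler_addgt0Pr => e e0.
  have en : 0 < e / n.+1%:R by rewrite divr_gt0.
  have [d [d0 /(_ n) Cd] dlt] := inf_adherent en Cinf.
  apply: (le_trans Cd); rewrite -lerBlDl series_sub.
  apply: (@le_trans _ _ (series (fun=> e / n.+1%:R) n)).
    apply: series_le => j; rewrite /capped; case: ifP => _.
      by rewrite subrr ltW.
    by apply: minr_diff_le; [exact: ltW | exact: ltW].
  by rewrite series_const mulrAC ler_pdivrMr // ler_pM2l // ler_nat.
(* With c = 0 the capped sequence would vanish from m on and have bounded partial sums, unlike
   [xi]. *)
have cp : 0 < c.
  rewrite lt_def c0 andbT; apply/eqP => ce.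
  have [n hn] := divergent_unbounded (series z m) xi0 xid.
  have := Cc n; rewrite leNgt => /negP; apply; apply: le_lt_trans hn.
  have e j : (m <= j)%N -> capped m c z j = 0.
    by move=> mj; rewrite /capped ltnNge mj /= ce min_r.
  have [cp0 _ _] := capped_c0star m c0 zc.
  apply: le_trans (series_finite_support _ cp0 e) _.
  exact: series_le (capped_le _ _ _).
(* From some p on, z is at most c, so capping costs the gap at most [series z p]. *)
have dom : dominates xi (capped m c z).
  split => //; first exact: capped_c0star.
  move=> A; have [p hp] := c0star_small zc cp.
  have [N hN] := zD (A + series z p).
  exists N => n Nn; have := hN n Nn.
  suff : series z n - series (capped m c z) n <= series z p by lra.
  have dpos j : 0 <= z j - capped m c z j by rewrite subr_ge0 capped_le.
  rewrite series_sub; apply: (le_trans (series_finite_support (p:=p) n dpos _)).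
    by move=> j /hp zj; rewrite /capped min_l // if_same subrr.
  have [cp0 _ _] := capped_c0star m c0 zc.
  by apply: series_le => j; rewrite gerBl.
suff [n mn hn] : exists2 n, (m <= n)%N & series xi n = series (capped m c z) n.
  exists (capped m c z), n; split => //; last exact: capped_le.
  by move=> j jm; rewrite /capped jm.
apply: contrapT => H.
have Dp n : (m <= n)%N -> 0 < series (capped m c z) n - series xi n.
  move=> mn; rewrite subr_gt0 lt_def Cc andbT; apply/eqP => h; apply: H.
  by exists n.
have [d d0 dle] : exists2 d : R, 0 < d &
    forall n, (m <= n)%N -> d <= series (capped m c z) n - series xi n.
  have [_ _ /(_ 1) [N hN]] := dom.
  have [d d0 hd] := positive_lower_bound N Dp.
  exists (Num.min d 1) => [|n mn]; first by rewrite lt_min d0 ltr01.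
  have [Nn|nN] := leqP N n; first by rewrite ge_min hN ?orbT.
  by rewrite ge_min hd ?mn.
have c20 : 0 < c / 2 by rewrite divr_gt0.
have [p hp] := c0star_small zc c20.
(* From p on z is at most c / 2, hence below both caps c and c - e. Lowering the cap by e thus
   affects at most p entries and costs at most e * p <= d; [p.+1] keeps the denominator nonzero. *)
pose e : R := Num.min (c / 2) (d / p.+1%:R).
have e0 : 0 < e by rewrite lt_min !divr_gt0.
have ec : e <= c / 2 by rewrite ge_min lexx.
have ed : e * p%:R <= d.
  apply: (@le_trans _ _ (d / p.+1%:R * p%:R)).
    by rewrite ler_wpM2r // ge_min lexx orbT.
  by rewrite mulrAC ler_pdivrMr // ler_pM2l // ler_nat.
have : C (c - e).
  split; first by lra.
  move=> n; have [mn|nm] := leqP m n; last first.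
    rewrite (@eq_series_lt (capped m (c - e) z) z) // => j jn.
    by rewrite /capped (ltn_trans jn nm).
  have := dle n mn.
  suff : series (capped m c z) n - series (capped m (c - e) z) n <= d by lra.
  have dpos j : 0 <= capped m c z j - capped m (c - e) z j.
    rewrite subr_ge0 /capped; case: ifP => // _.
    by rewrite le_min !ge_min lexx /= gerBl (ltW e0) orbT.
  rewrite series_sub; apply: (le_trans (series_finite_support (p:=p) n dpos _)).
    move=> j /hp zj; rewrite /capped !min_l ?if_same ?subrr//; lra.
  apply: le_trans ed; apply: (@le_trans _ _ (series (fun=> e) p)).
    apply: series_le => j; rewrite /capped; case: ifP => _; first by rewrite subrr ltW.
    by apply: minr_diff_le; [exact: ltW | rewrite subrK].
  by rewrite series_const.
by have [_ h] := Cinf; move=> /(inf_lbound h); rewrite -/c; lra.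
Qed.

Lemma block_majorized_below xi eta : (forall j, 0 <= xi j) ->
  ~ cvgn (series xi) -> c0star eta -> majorized xi eta ->
  exists zeta, [/\ c0star zeta, forall n, zeta n <= 2 * eta n &
    block_majorized xi zeta].
Proof.
move=> xi0 xid ec em.
have [e0 ed el] := ec.
have dom : dominates xi (fun n => 2 * eta n).
  have S2 n : series (fun n => 2 * eta n) n = 2 * series eta n.
    by rewrite /series /= mulr_sumr.
  split.
  - split => [n||]; first by rewrite mulr_ge0.
      by apply/nonincreasing_seqP => n; rewrite ler_pM2l //; apply: ed.
    by rewrite -(mulr0 2); apply: cvgM => //; apply: cvg_cst.
  - by move=> n; rewrite S2; have := em n; have := series_ge0 n xi0; lra.
  - move=> A; have [N hN] := divergent_unbounded A xi0 xid.
    exists N => n Nn; rewrite S2; have := em n; have := series_mono xi0 Nn; lra.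
(* A state is a sequence together with its latest meeting index; the entries up to and including
   that index are frozen afterwards. *)
have [p|g Hg] := @choice _ _ (fun p q : R^nat * nat => dominates xi p.1 ->
   [/\ dominates xi q.1, (p.2 < q.2)%N,
    forall j, (j <= p.2)%N -> q.1 j = p.1 j, forall j, q.1 j <= p.1 j &
    series xi q.2 = series q.1 q.2]).
  case: p => z m.
  have [dz|ndz] := pselect (dominates xi z); last by exists (z, m).
  have [z' [n [? ? ? ? ?]]] := capped_touch m.+1 xi0 xid dz.
  by exists (z', n).
pose zn k := iter k g (fun n => 2 * eta n, 0%N).
have znD k : dominates xi (zn k).1.
  by elim: k => [//|k IH]; have [] := Hg _ IH.
have nS k : ((zn k).2 < (zn k.+1).2)%N by have [] := Hg _ (znD k).
have nk k : (k <= (zn k).2)%N.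
  by elim: k => // k IH; apply: leq_ltn_trans IH (nS k).
have agree k l j : (k <= l)%N -> (j <= (zn k).2)%N -> (zn l).1 j = (zn k).1 j.
  move=> /subnKC <- jk; elim: (l - k)%N => [|i IH]; first by rewrite addn0.
  rewrite addnS -IH; have [_ _ h _ _] := Hg _ (znD (k + i)%N).
  apply: h; apply: leq_trans jk _; elim: (i) => [|i' IH']; first by rewrite addn0.
  by rewrite addnS (leq_trans IH') // ltnW.
(* Diagonal limit: the meeting index at stage j is at least j, so entry j no longer changes after
   stage j. *)
pose zeta : R^nat := fun j => (zn j).1 j.
have zetaE k j : (j <= (zn k).2)%N -> zeta j = (zn k).1 j.
  move=> jk; have [kj|/ltnW jk'] := leqP k j; first by rewrite /zeta (agree k).
  by rewrite /zeta -(agree j k).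
have znle k j : (zn k).1 j <= 2 * eta j.
  elim: k => // k IH; apply: le_trans IH; have [_ _ _ h _] := Hg _ (znD k).
  exact: h.
have zeta0 j : 0 <= zeta j by have [[h _ _] _ _] := znD j; exact: h.
exists zeta; split.
- split => //.
    apply/nonincreasing_seqP => j; have [[_ zd _] _ _] := znD j.+1.
    rewrite (zetaE j.+1 j) ?(leq_trans _ (nk j.+1)) //.
    by rewrite /zeta; apply: zd.
  have [[_ _ c2] _ _] := dom.
  apply: (squeeze_cvgr _ (cvg_cst 0) c2).
  by near=> n; rewrite zeta0 znle.
- by move=> n; apply: znle.
- split.
    move=> n; have [_ h _] := znD n.
    rewrite (@eq_series_lt zeta (zn n).1) //.
    by move=> j jn; rewrite (zetaE n) // (leq_trans (ltnW jn)).
  exists (fun k => (zn k.+1).2); split.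
    exact: (homo_ltn ltn_trans (fun k => nS k.+1)).
  move=> k; have [_ _ _ _ ->] := Hg _ (znD k).
  apply: eq_series_lt => j jn; rewrite (zetaE k.+1) //; exact: ltnW.
Unshelve. all: by end_near. Qed.

End RealSequences.

(** * Horn's theorem by plane rotations *)

Section Horn.
Variable R : rcfType.

(** For t = s / c the condition reads (v - d) t^2 - 2 b t - (a - v) = 0. Its reduced discriminant D
    is nonnegative because v lies between d and a, so a root is available in any real closed field.
    For v = d the equation degenerates and c = 0, s = 1 is taken. *)
Lemma rotation_to (a b d v : R) : d <= v <= a ->
  exists c s : R, c ^+ 2 + s ^+ 2 = 1 /\ c ^+ 2 * a + 2 * (c * s) * b + s ^+ 2 * d = v.
Proof.
case/andP=> dv va; have [->|] := eqVneq d v; first by exists 0, 1; split; ring.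
move=> ndv; have w0 : 0 < v - d by rewrite subr_gt0 lt_neqAle ndv.
pose D := b ^+ 2 + (v - d) * (a - v).
have D0 : 0 <= D by rewrite addr_ge0 ?sqr_ge0 // mulr_ge0 ?(ltW w0) // subr_ge0.
pose t := (b + Num.sqrt D) / (v - d).
have tE : a + 2 * t * b + t ^+ 2 * d = v * (1 + t ^+ 2).
  have : (v - d) * t = b + Num.sqrt D by rewrite mulrC divfK // lt0r_neq0.
  have : Num.sqrt D ^+ 2 = D by rewrite sqr_sqrtr.
  rewrite /D; move: (Num.sqrt D) => q q2 tq.
  have q3 : q = (v - d) * t - b by rewrite tq; ring.
  move: q2; rewrite {}q3 => /(congr1 (fun z => z - b ^+ 2)) h.
  apply/eqP; rewrite -subr_eq0; apply/eqP.
  apply: (mulfI (lt0r_neq0 w0)); rewrite mulr0.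
  by apply: etrans (_ : (b ^+ 2 + (v - d) * (a - v) - b ^+ 2) - (((v - d) * t - b) ^+ 2 - b ^+ 2) = 0);
    [ring | rewrite h subrr].
have u0 : 0 < 1 + t ^+ 2 by rewrite ltr_wpDr ?sqr_ge0.
pose c : R := (Num.sqrt (1 + t ^+ 2))^-1.
have c2 : c ^+ 2 * (1 + t ^+ 2) = 1.
  by rewrite exprVn sqr_sqrtr ?(ltW u0) // mulVf // lt0r_neq0.
exists c, (t * c); split; first by rewrite -c2; ring.
transitivity (c ^+ 2 * (a + 2 * t * b + t ^+ 2 * d)); first by ring.
by rewrite tE mulrCA c2 mulr1.
Qed.

(** The entries of U diag(w) U^T. The weight 1 expresses orthogonality and the weight y carries the
    diagonal to be prescribed, so one bilinear expansion serves both. *)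
Definition weighted_gram n (w : 'I_n -> R) (U : 'M[R]_n) a b :=
  \sum_j w j * (U a j * U b j).

Lemma weighted_gramC n (w : 'I_n -> R) U a b :
  weighted_gram w U a b = weighted_gram w U b a.
Proof. by apply: eq_bigr => j _; rewrite (mulrC (U a j)). Qed.

Lemma weighted_gram_comb n (w : 'I_n -> R) (U V : 'M[R]_n) p q f g a b :
  (forall l j, V l j = p l * U (f l) j + q l * U (g l) j) ->
  weighted_gram w V a b =
    p a * p b * weighted_gram w U (f a) (f b) +
    p a * q b * weighted_gram w U (f a) (g b) +
    q a * p b * weighted_gram w U (g a) (f b) +
    q a * q b * weighted_gram w U (g a) (g b).
Proof.
move=> VE; rewrite /weighted_gram !mulr_sumr -!big_split /=.
by apply: eq_bigr => j _; rewrite !VE; ring.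
Qed.

Lemma orthogonal_gramP n (U : 'M[R]_n) :
  U *m U^T = 1%:M <-> forall a b, weighted_gram (fun=> 1) U a b = (a == b)%:R.
Proof.
have E a b : (U *m U^T) a b = weighted_gram (fun=> 1) U a b.
  by rewrite mxE; apply: eq_bigr => j _; rewrite !mxE mul1r.
split=> [H a b|H]; first by rewrite -E H mxE.
by apply/matrixP => a b; rewrite E H mxE.
Qed.

Definition conj_diag n (U : 'M[R]_n) (y : 'I_n -> R) i := \sum_j U i j ^+ 2 * y j.

Lemma conj_diagE n (U : 'M[R]_n) y i : conj_diag U y i = weighted_gram y U i i.
Proof. by apply: eq_bigr => j _; rewrite expr2 mulrC. Qed.

(** Rotating rows i and k within their plane keeps all rows orthonormal and preserves the sum of the
    two diagonal entries, so prescribing one of them determines the other. *)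
Lemma rotate_rows n (U : 'M[R]_n) (y : 'I_n -> R) i k v : i != k ->
  U *m U^T = 1%:M -> conj_diag U y k <= v <= conj_diag U y i ->
  exists V : 'M[R]_n, V *m V^T = 1%:M /\
    forall l, conj_diag V y l =
      if l == i then v else
      if l == k then conj_diag U y i + conj_diag U y k - v else conj_diag U y l.
Proof.
move=> ik /orthogonal_gramP UU.
move=> /(rotation_to (weighted_gram y U i k)) [c [s [cs1 csv]]].
(* All rows of V share the shape p U_f + q U_k: the new row i is c U_i + s U_k and the new row k is
   - s U_i + c U_k. *)
pose p l := if l == i then c else if l == k then - s else 1.
pose q l := if l == i then s else if l == k then c else 0.
pose f l := if l == k then i else l.
pose g (l : 'I_n) := k.
pose V : 'M[R]_n := \matrix_(l, j) (p l * U (f l) j + q l * U (g l) j).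
have VE l j : V l j = p l * U (f l) j + q l * U (g l) j by rewrite mxE.
exists V; split.
  apply/orthogonal_gramP => a b; rewrite (weighted_gram_comb _ _ _ VE) !UU /p /q /f /g.
  have ki : (k == i) = false by rewrite eq_sym (negPf ik).
  have [->|ai] := eqVneq a i; have [->|bi] := eqVneq b i.
  - by rewrite !(eqxx, negPf ik, ki) /= ?(eqxx, negPf ik, ki) /=; transitivity (c ^+ 2 + s ^+ 2) => //; ring.
  - rewrite !(eqxx, negPf ik, ki) /= ?(eqxx, negPf ik, ki) /=; have [bk|bk] := eqVneq b k; rewrite ?bk.
      by rewrite ?(eqxx, negPf ik, ki) /= ?(eqxx, negPf ik, ki) /=; ring.
    by rewrite [i == b]eq_sym [k == b]eq_sym (negPf bi) (negPf bk) /=; ring.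
  - rewrite !(eqxx, negPf ik, ki) /= ?(eqxx, negPf ik, ki) /=; have [ak|ak] := eqVneq a k; rewrite ?ak.
      by rewrite ?(eqxx, negPf ik, ki) /= ?(eqxx, negPf ik, ki) /=; ring.
    by rewrite (negPf ai) (negPf ak) /=; ring.
  have [ak|ak] := eqVneq a k; have [bk|bk] := eqVneq b k; rewrite ?ak ?bk ?(eqxx, negPf ik, ki) /= ?(eqxx, negPf ik, ki) /=.
  - by transitivity (c ^+ 2 + s ^+ 2) => //; ring.
  - by rewrite [i == b]eq_sym [k == b]eq_sym (negPf bi) (negPf bk) /=; ring.
  - by rewrite (negPf ai) (negPf ak) /=; ring.
  - by ring.
move=> l; rewrite !conj_diagE (weighted_gram_comb _ _ _ VE) /p /q /f /g.
rewrite !conj_diagE in csv.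
have [->|li] := eqVneq l i.
  by rewrite (negPf ik) -csv (weighted_gramC y U k i); ring.
have [_|lk] := eqVneq l k; last by ring.
rewrite -csv (weighted_gramC y U k i).
have -> : c ^+ 2 = 1 - s ^+ 2 by rewrite -cs1; ring.
have -> : c * c = 1 - s ^+ 2 by rewrite -cs1; ring.
ring.
Qed.

(* Each step moves the diagonal one T-transform closer to x by rotating two rows
   of U, and fixes at least one of its entries for good. *)
Lemma horn_chain n (x y : 'I_n -> R) : (forall i j : 'I_n, (i <= j)%N -> x j <= x i) ->
  forall N (U : 'M[R]_n), U *m U^T = 1%:M ->
  (#|[pred l | (conj_diag U y l - x l != 0)%R]| <= N)%N ->
  (forall k : nat, 0 <= \sum_(l < n | (l < k)%N) (conj_diag U y l - x l)) ->
  \sum_l (conj_diag U y l - x l) = 0 ->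
  exists V : 'M[R]_n, V *m V^T = 1%:M /\ forall l, conj_diag V y l = x l.
Proof.
move=> xd; elim=> [|N IH] U UU; set d := fun l => conj_diag U y l - x l.
  rewrite leqn0 => /eqP/card0_eq E _ _; exists U; split => // l.
  by apply/eqP; rewrite -subr_eq0; have := E l; rewrite !inE => /negbFE.
move=> cN ps s0.
have [/existsP[i0 hi0]|] := boolP [exists l, d l != 0]; last first.
  rewrite negb_exists => /forallP h; exists U; split => // l.
  by apply/eqP; rewrite -subr_eq0; have := h l; rewrite negbK.
(* i is the first nonzero deviation, positive because the partial sums of d are nonnegative; k will
   be the first negative deviation, which comes after i. *)
have [i di imin] := @arg_minnP _ i0 (fun l => d l != 0) (@nat_of_ord n) hi0.
have d0 (l : 'I_n) : (l < i)%N -> d l = 0.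
  by move=> li; apply/eqP; apply: contraTT li => /imin; rewrite -leqNgt.
have dip : 0 < d i.
  rewrite lt_neqAle eq_sym di /=; have := ps i.+1; rewrite (bigD1 i) //=.
  rewrite big1 ?addr0 // => l /andP[li nli]; apply: d0.
  by rewrite ltn_neqAle -ltnS li andbT; apply: contra nli => /eqP h; apply/eqP/val_inj.
have [/existsP[k0 hk0]|] := boolP [exists l, d l < 0]; last first.
  rewrite negb_exists => /forallP h.
  have : 0 < \sum_l d l.
    rewrite (bigD1 i) //= ltr_wpDr // sumr_ge0 // => l _; rewrite leNgt; exact: h.
  by rewrite s0 ltxx.
have [k dk kmin] := @arg_minnP _ k0 (fun l => d l < 0) (@nat_of_ord n) hk0.
have dpos (l : 'I_n) : (l < k)%N -> 0 <= d l.
  by move=> lk; rewrite leNgt; apply: contraTN lk => /kmin; rewrite -leqNgt.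
have nik : i != k by apply: contraTneq dk => <-; rewrite -leNgt ltW.
have ik : (i < k)%N.
  rewrite ltnNge; apply: contraTN dk; rewrite leq_eqVlt => /orP[/eqP/val_inj h|/d0 ->].
    by rewrite h eqxx in nik.
  by rewrite ltxx.
(* The largest amount that can move from i to k without overshooting either target; at least one of
   the two deviations becomes 0. *)
pose e := Num.min (d i) (- d k).
have e0 : 0 < e by rewrite lt_min dip oppr_gt0.
have ei : e <= d i by rewrite ge_min lexx.
have ek : e <= - d k by rewrite ge_min lexx orbT.
have rng : conj_diag U y k <= conj_diag U y i - e <= conj_diag U y i.
  (* The diagonal entry at k is below x k <= x i, which is at most the diagonal entry at i minus
     e. *)
  have xik := xd _ _ (ltnW ik).
  by apply/andP; split; move: ei ek e0; rewrite /d => *; lra.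
have [V [VV dV]] := rotate_rows nik UU rng.
have dVE l : conj_diag V y l - x l = d l - e * (l == i)%:R + e * (l == k)%:R.
  rewrite dV /d; have [->|] := eqVneq l i; first by rewrite (negPf nik) /=; ring.
  by have [->|] := eqVneq l k => *; rewrite /=; ring.
apply: (IH V VV).
- rewrite -ltnS; apply: leq_trans cN; apply: proper_card.
  apply/properP; split.
    apply/fintype.subsetP => l; rewrite !inE dVE -/(d l).
    have [->|] := eqVneq l i; first by rewrite di.
    have [->|] := eqVneq l k; first by rewrite [d k == 0]lt_eqF.
    by rewrite !mulr0 subr0 addr0.
  have [h|h] := leP (d i) (- d k).
    exists i; first by rewrite inE -/(d i).
    by rewrite inE dVE eqxx (negPf nik) /e min_l // negbK mulr1 mulr0 addr0 subrr eqxx.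
  exists k; first by rewrite inE -/(d k) lt_eqF.
  by rewrite inE dVE eqxx [k == i]eq_sym (negPf nik) /e min_r ?ltW // negbK mulr0 subr0 mulr1 addrN eqxx.
- move=> m; rewrite (eq_bigr _ (fun l _ => dVE l)) big_split /= sumrB -!mulr_sumr.
  have delta (a : 'I_n) : \sum_(l < n | (l < m)%N) (l == a)%:R = ((a < m)%N)%:R :> R.
    rewrite big_mkcond /= (bigD1 a) //= eqxx big1 ?addr0; first by case: ifP.
    by move=> l /negPf ->; case: ifP.
  rewrite !delta; have [mk|km] := leqP m k; last first.
    by rewrite (ltn_trans ik km) addrNK; exact: ps.
  have [im|mi] := ltnP i m; last by rewrite !mulr0 subr0 addr0; exact: ps.
  (* For i < m <= k the partial sum drops by e <= d i, while the remaining terms are nonnegative as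
     they precede the first negative deviation. *)
  rewrite mulr0 addr0 mulr1 subr_ge0; apply: le_trans ei _.
  rewrite (bigD1 i) //= lerDl sumr_ge0 // => l /andP[lm _]; apply: dpos.
  exact: leq_trans lm mk.
- rewrite (eq_bigr _ (fun l _ => dVE l)) big_split /= sumrB -!mulr_sumr s0.
  have delta (a : 'I_n) : \sum_l (l == a)%:R = 1 :> R.
    by rewrite (bigD1 a) //= eqxx big1 ?addr0 // => l /negPf ->.
  by rewrite !delta sub0r addNr.
Qed.

Theorem horn n (x y : 'I_n -> R) : (forall i j : 'I_n, (i <= j)%N -> x j <= x i) ->
  (forall k : nat, \sum_(l < n | (l < k)%N) x l <= \sum_(l < n | (l < k)%N) y l) ->
  \sum_l x l = \sum_l y l ->
  exists V : 'M[R]_n, V *m V^T = 1%:M /\ forall l, conj_diag V y l = x l.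
Proof.
move=> xd xy xys.
have d1 l : conj_diag 1%:M y l = y l.
  rewrite /conj_diag (bigD1 l) //= mxE eqxx expr1n mul1r big1 ?addr0 // => j.
  by rewrite mxE eq_sym => /negPf ->; rewrite expr0n mul0r.
apply: (@horn_chain _ _ y xd _ 1%:M); rewrite ?trmx1 ?mulmx1 //.
  by move=> k; rewrite sumrB subr_ge0 (eq_bigr _ (fun l _ => d1 l)).
by rewrite sumrB (eq_bigr _ (fun l _ => d1 l)) xys subrr.
Qed.

End Horn.

(** * Squared moduli as real numbers, and convergence in epsilon form *)

Section Modulus.
Variable R : realType.
Local Notation C := R[i].
Implicit Types (a b : C).

(** Takes values in R, so that estimates use its total order rather than the partial order of
    R[i]. *)
Definition csq (a : C) : R := complex.Re a ^+ 2 + complex.Im a ^+ 2.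

Lemma csqE a : (csq a)%:C%C = `|a| ^+ 2.
Proof. exact: add_Re2_Im2. Qed.

Lemma csq_conjE a : (csq a)%:C%C = a * a^*.
Proof. by rewrite csqE normCK. Qed.

Lemma csq_ge0 a : 0 <= csq a. Proof. by rewrite addr_ge0 ?sqr_ge0. Qed.

Lemma csq0 : csq 0 = 0. Proof. by rewrite /csq /= expr0n addr0. Qed.

Lemma csq_eq0 a : csq a = 0 -> a = 0.
Proof.
by move/(congr1 (fun r => r%:C%C)); rewrite csqE => /eqP; rewrite sqrf_eq0 normr_eq0 => /eqP.
Qed.

Lemma csqM a b : csq (a * b) = csq a * csq b.
Proof.
by apply: (@complexI R); rewrite rmorphM /= !csqE normrM exprMn.
Qed.

Lemma csq_conj a : csq a^* = csq a.
Proof. by apply: (@complexI R); rewrite !csqE norm_conjC. Qed.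

Lemma csqN a : csq (- a) = csq a.
Proof. by apply: (@complexI R); rewrite !csqE normrN. Qed.

Lemma csqB a b : csq (a - b) = csq (b - a).
Proof. by rewrite -csqN opprB. Qed.

Lemma csq_real (r : R) : csq (r%:C%C) = r ^+ 2.
Proof. by rewrite /csq /= expr0n addr0. Qed.

Lemma csqD a b : csq (a + b) <= 2 * csq a + 2 * csq b.
Proof.
case: a b => [a a'] [b b']; rewrite /csq /=.
rewrite -subr_ge0; apply: (@le_trans _ _ ((a - b) ^+ 2 + (a' - b') ^+ 2)).
  by rewrite addr_ge0 ?sqr_ge0.
by rewrite le_eqVlt; apply/orP; left; apply/eqP; ring.
Qed.

(** One-sided on purpose: for nonnegative d this is convergence to 0, and it passes to any smaller
    sequence. *)
Definition vanishes (d : nat -> R) :=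
  forall e, 0 < e -> exists N, forall n, (N <= n)%N -> d n <= e.

Lemma vanishes_le d d' : (forall n, d n <= d' n) -> vanishes d' -> vanishes d.
Proof.
by move=> h v e /v [N hN]; exists N => n /hN; exact: le_trans.
Qed.

Lemma vanishesD d d' : vanishes d -> vanishes d' -> vanishes (fun n => d n + d' n).
Proof.
move=> v v' e e0; have e2 : 0 < e / 2 by rewrite divr_gt0.
have [[N hN] [N' hN']] := (v _ e2, v' _ e2).
exists (maxn N N') => n; rewrite geq_max => /andP[/hN h /hN' h'].
by rewrite [e]splitr lerD.
Qed.

Lemma vanishesZ (k : R) d : 0 <= k -> vanishes d -> vanishes (fun n => k * d n).
Proof.
move=> k0 v e e0; have k1 : 0 < k + 1 by rewrite ltr_wpDl.
have [N hN] := v _ (divr_gt0 e0 k1).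
exists N => n /hN dn; apply: (@le_trans _ _ (k * (e / (k + 1)))).
  by rewrite ler_wpM2l.
by rewrite mulrCA ger_pMr // ler_pdivrMr // mul1r lerDl.
Qed.

Lemma vanishes_const (r : R) : vanishes (fun=> r) -> r <= 0.
Proof.
by move=> v; apply/ler_addgt0Pr => e /v [N hN]; rewrite add0r (hN N).
Qed.

Lemma vanishes_csq a : vanishes (fun=> csq a) -> a = 0.
Proof.
move=> /vanishes_const h; apply: csq_eq0; apply/eqP.
by rewrite eq_le h csq_ge0.
Qed.

Lemma vanishes_Re (d : nat -> C) :
  vanishes (fun n => csq (d n)) -> vanishes (fun n => `|complex.Re (d n)|).
Proof.
move=> v e e0; have [N hN] := v _ (exprn_gt0 2 e0); exists N => n /hN h.
rewrite -(@ler_pXn2r _ 2) ?nnegrE ?(ltW e0) // real_normK ?num_real //.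
by apply: le_trans h; rewrite lerDl sqr_ge0.
Qed.

Lemma eventually_vanishes (d : nat -> R) N : (forall n, (N <= n)%N -> d n <= 0) ->
  vanishes d.
Proof. by move=> h e e0; exists N => n /h dn; apply: le_trans dn (ltW e0). Qed.

End Modulus.

(** * Cauchy-Schwarz, Bessel, orthonormal expansions and Parseval *)

Section HilbertSpace.
Variables (R : realType) (H : completeNormedModType R[i]).
Variable dot : {dot H for Num.conj}.
Hypothesis Hn : hilbert_norm dot.
Local Notation C := R[i].
Implicit Types (x y z : H) (a b : C).

Definition sq x : R := complex.Re (dot x x).

Lemma sqE x : (sq x)%:C%C = dot x x.
Proof. by apply: RRe_real; apply: ger0_real; apply: dnorm_ge0. Qed.

Lemma sq_norm x : (sq x)%:C%C = `|x| ^+ 2.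
Proof. by rewrite sqE Hn. Qed.

Lemma sq_ge0 x : 0 <= sq x.
Proof. by rewrite -ler0c sqE dnorm_ge0. Qed.

Lemma sq_eq0 x : sq x = 0 -> x = 0.
Proof.
by move/(congr1 (fun r => r%:C%C)); rewrite sqE => /eqP; rewrite dnorm_eq0 => /eqP.
Qed.

Lemma sq0 : sq 0 = 0.
Proof. by apply: (@complexI R); rewrite sqE linear0l. Qed.

Lemma dotC x y : dot x y = (dot y x)^*.
Proof. by rewrite hermC mul1r. Qed.

Lemma dotZl a x y : dot (a *: x) y = a * dot x y.
Proof. by rewrite linearZl_LR. Qed.

Lemma dotZr a x y : dot x (a *: y) = a^* * dot x y.
Proof. by rewrite linearZr_LR. Qed.

Lemma sqZ a x : sq (a *: x) = csq a * sq x.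
Proof. by apply: (@complexI R); rewrite sqE dnormZ rmorphM /= csqE sqE. Qed.

Lemma sqN x : sq (- x) = sq x.
Proof. by apply: (@complexI R); rewrite !sqE hnormN. Qed.

Lemma sqB x y : sq (x - y) = sq (y - x).
Proof. by rewrite -sqN opprB. Qed.

Lemma sqDo x y : dot x y = 0 -> sq (x + y) = sq x + sq y.
Proof.
by move=> o; apply: (@complexI R); rewrite rmorphD /= !sqE hnormDd.
Qed.

Lemma cauchy_schwarz x y : csq (dot x y) <= sq x * sq y.
Proof.
have [->|y0] := eqVneq y 0.
  by rewrite linear0r csq0 mulr_ge0 // sq_ge0.
have dy0 : dot y y != 0 by rewrite dnorm_eq0.
pose c := dot x y / dot y y.
have o : dot (x - c *: y) (c *: y) = 0.
  by rewrite dotZr linearBl /= dotZl divfK // subrr mulr0.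
have := sqDo o; rewrite subrK sqZ => ->.
rewrite mulrDl -mulrA -expr2 -csq_real sqE -csqM divfK // lerDr.
by rewrite mulr_ge0 // sq_ge0.
Qed.

Lemma sq_sumo (f : nat -> H) m n : (forall i j, i != j -> dot (f i) (f j) = 0) ->
  sq (\sum_(m <= k < n) f k) = \sum_(m <= k < n) sq (f k).
Proof.
move=> fo; have [mn|/ltnW nm] := leqP m n; last by rewrite !big_geq // sq0.
rewrite -(subnKC mn); elim: (n - m)%N => [|k IH]; first by rewrite addn0 !big_geq // sq0.
rewrite addnS !big_nat_recr ?leq_addr //= sqDo ?IH // linear_sumlz big_nat_cond big1 //= => i.
by rewrite andbT => /andP[_ ik]; apply: fo; rewrite ltn_eqF.
Qed.

Lemma norm_le_sq x (e : R) : 0 <= e -> (`|x| <= e%:C%C) = (sq x <= e ^+ 2).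
Proof.
move=> e0; rewrite -lecR sq_norm rmorphXn /= ler_pXn2r ?nnegrE ?ler0c //.
Qed.

Lemma cvg_vanishes (u : nat -> H) l :
  u @ \oo --> l <-> vanishes (fun n => sq (u n - l)).
Proof.
split=> [/cvgrPdist_le h e e0|v].
  have s0 : 0 < (Num.sqrt e)%:C%C by rewrite ltcR sqrtr_gt0.
  have [N _ hN] := h _ s0; exists N => n /hN.
  by rewrite norm_le_sq ?sqrtr_ge0 // sqr_sqrtr ?(ltW e0) // sqB.
apply/cvgrPdist_le => e e0; have er : e \is Num.real by apply: gtr0_real.
have e'0 : 0 < complex.Re e by rewrite -ltcR RRe_real.
have [N hN] := v _ (exprn_gt0 2 e'0).
by exists N => // n /hN; rewrite -(RRe_real er) norm_le_sq ?(ltW e'0) // sqB.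
Qed.

Lemma cauchy_sq_cvg (u : nat -> H) :
  (forall e, 0 < e -> exists N, forall m n, (N <= m)%N -> (m <= n)%N -> sq (u n - u m) <= e) ->
  cvgn u.
Proof.
move=> hu; apply: cauchy_cvg; apply: cauchy_exP => e e0.
have er : e \is Num.real by apply: gtr0_real.
have e'0 : 0 < complex.Re e by rewrite -ltcR RRe_real.
have e'1 : 0 < complex.Re e / 2 by rewrite divr_gt0.
have [N hN] := hu _ (exprn_gt0 2 e'1).
exists (u N), N => // n /= /(hN N) h; rewrite -ball_normE /=.
apply: (@le_lt_trans _ _ (complex.Re e / 2)%:C%C).
  by rewrite norm_le_sq ?(ltW e'1) // sqB h.
by rewrite -[ltRHS](RRe_real er) ltcR ltr_pdivrMr // ltr_pMr // ltr1n.
Qed.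

(** Zero vectors are allowed, because normalizing [X (f n)] by a zero singular number yields 0. *)
Definition suborthonormal (f : nat -> H) :=
  (forall i j, i != j -> dot (f i) (f j) = 0) /\ forall i, sq (f i) <= 1.

Lemma orthonormal_suborthonormal f : orthonormal_seq dot f -> suborthonormal f.
Proof.
move=> o; split=> [i j /negPf ij|i]; first by rewrite o ij.
by rewrite -lecR sqE o eqxx.
Qed.

Lemma dot_sum_r x (c : nat -> C) (f : nat -> H) n :
  dot x (series (fun k => c k *: f k) n) = \sum_(0 <= k < n) (c k)^* * dot x (f k).
Proof. by rewrite /series /= linear_sumr; apply: eq_bigr => k _; exact: dotZr. Qed.

Lemma dot_sum_l x (c : nat -> C) (f : nat -> H) n :
  dot (series (fun k => c k *: f k) n) x = \sum_(0 <= k < n) c k * dot (f k) x.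
Proof. by rewrite /series /= linear_sumlz; apply: eq_bigr => k _; exact: dotZl. Qed.

Lemma sq_lincomb f (c : nat -> C) m n : suborthonormal f ->
  sq (\sum_(m <= k < n) c k *: f k) <= \sum_(m <= k < n) csq (c k).
Proof.
case=> fo f1; rewrite sq_sumo; last first.
  by move=> i j ij; rewrite dotZl dotZr fo // !mulr0.
by apply: ler_sum => k _; rewrite sqZ ler_piMr // csq_ge0.
Qed.

(** For the partial expansion z one has <x, z> = s and |z|^2 <= s, so Cauchy-Schwarz gives s^2 <=
    |x|^2 s. Norms at most 1 suffice for this, whereas a projection argument would ask for norm
    1. *)
Lemma bessel f x n : suborthonormal f ->
  series (fun k => csq (dot x (f k))) n <= sq x.
Proof.
move=> fs; set s := series _ n.
pose z := series (fun k => dot x (f k) *: f k) n.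
have zs : sq z <= s by apply: sq_lincomb.
have s0 : 0 <= s by rewrite sumr_ge0 // => k _; apply: csq_ge0.
have xz : dot x z = s%:C%C.
  rewrite dot_sum_r /s /series /= rmorph_sum /=; apply: eq_bigr => k _.
  by rewrite csq_conjE mulrC.
have := cauchy_schwarz x z; rewrite xz csq_real => h.
have [s00|sp] := eqVneq s 0; first by rewrite s00 sq_ge0.
have sp' : 0 < s by rewrite lt_neqAle eq_sym sp.
rewrite -(ler_pM2r sp') -expr2; apply: le_trans h _.
by rewrite ler_wpM2l // sq_ge0.
Qed.

Definition square_summable (c : nat -> C) (M : R) :=
  forall n, series (fun k => csq (c k)) n <= M.

Definition synth (f : nat -> H) (c : nat -> C) : H :=
  limn (series (fun k => c k *: f k)).

Lemma synth_cvg f c M : suborthonormal f -> square_summable c M ->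
  series (fun k => c k *: f k) @ \oo --> synth f c.
Proof.
move=> fs cM; suff h : cvgn (series (fun k => c k *: f k)) by [].
apply: cauchy_sq_cvg => e e0.
have : cvgn (series (fun k => csq (c k))).
  apply: nondecreasing_is_cvgn.
    by apply/nondecreasing_seqP => n; rewrite /series /= big_nat_recr //= lerDl csq_ge0.
  by exists M => _ [n _ <-].
move=> /cvgrPdist_le /(_ _ (divr_gt0 e0 (ltr0Sn _ 1))) [N _ hN].
exists N => m n Nm mn.
rewrite sub_series_geq //; apply: le_trans (sq_lincomb _ _ _ fs) _.
rewrite -(sub_series_geq (fun k => csq (c k))) //.
have h1 := hN m Nm; have h2 := hN n (leq_trans Nm mn).
apply: le_trans (ler_norm _) _; rewrite [e]splitr.
apply: le_trans (ler_distD (limn (series (fun k => csq (c k)))) _ _) _.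
by rewrite lerD // distrC.
Qed.

Lemma dot_cvg_l (u : nat -> H) l y : u @ \oo --> l ->
  vanishes (fun n => csq (dot (u n) y - dot l y)).
Proof.
move=> /cvg_vanishes v; apply: vanishes_le (vanishesZ (sq_ge0 y) v) => n.
by rewrite -linearBl mulrC cauchy_schwarz.
Qed.

Lemma dot_cvg_eq (u : nat -> H) l y (s : nat -> C) a : u @ \oo --> l ->
  (forall n, dot (u n) y = s n) -> vanishes (fun n => csq (s n - a)) -> dot l y = a.
Proof.
move=> ul us sa; apply/eqP; rewrite -subr_eq0; apply/eqP; apply: vanishes_csq.
have v := dot_cvg_l y ul.
apply: vanishes_le (vanishesD (vanishesZ (ler0n _ 2) v) (vanishesZ (ler0n _ 2) sa)) => n.
rewrite -us -[dot (u n) y - dot l y]opprB csqN; apply: le_trans (csqD _ _).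
by rewrite addrC addrA subrK addrC.
Qed.

Lemma synth_dot f c M x : suborthonormal f -> square_summable c M ->
  vanishes (fun n => csq (dot (synth f c) x - \sum_(0 <= k < n) c k * dot (f k) x)).
Proof.
move=> fs cM; apply: vanishes_le (dot_cvg_l x (synth_cvg fs cM)) => n.
by rewrite dot_sum_l csqB.
Qed.

Lemma synth_coef f c M i : orthonormal_seq dot f -> square_summable c M ->
  dot (synth f c) (f i) = c i.
Proof.
move=> fo cM; have fs := orthonormal_suborthonormal fo.
apply: (dot_cvg_eq (synth_cvg fs cM)) => [n|]; first exact: dot_sum_l.
apply: (eventually_vanishes (N := i.+1)) => n ni.
rewrite (bigD1_seq i) ?iota_uniq ?mem_index_iota //= fo eqxx mulr1 big1 ?addr0.
  by rewrite subrr csq0.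
by move=> k /negPf ki; rewrite fo ki mulr0.
Qed.

Lemma sq_diff x y : sq x - sq y = sq (x - y) + 2 * complex.Re (dot (x - y) y).
Proof.
have e : (2 * complex.Re (dot (x - y) y))%:C%C = dot (x - y) y + (dot (x - y) y)^*.
  by rewrite rmorphM /= rmorph_nat -addcJ.
apply: (@complexI R); rewrite !rmorphD rmorphN /= e !sqE.
rewrite -{1 2}(subrK y x) dnormD; ring.
Qed.

Lemma sq_cvg (u : nat -> H) l : u @ \oo --> l -> vanishes (fun n => `|sq (u n) - sq l|).
Proof.
move=> ul; have /vanishes_Re v := dot_cvg_l l ul; have /cvg_vanishes w := ul.
apply: vanishes_le (vanishesD w (vanishesZ (ler0n _ 2) v)) => n.
rewrite sq_diff; apply: le_trans (ler_normD _ _) _.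
by rewrite (ger0_norm (sq_ge0 _)) lerD // normrM ger0_norm // linearBl.
Qed.

Lemma sq_cvg_le (u : nat -> H) l M : u @ \oo --> l -> (forall n, sq (u n) <= M) -> sq l <= M.
Proof.
move=> /sq_cvg ul uM; rewrite -subr_le0; apply: vanishes_const.
apply: vanishes_le ul => n; rewrite distrC; apply: le_trans (ler_norm _).
by rewrite lerB.
Qed.

Lemma sq_synth_le f c M : suborthonormal f -> square_summable c M -> sq (synth f c) <= M.
Proof.
move=> fs cM; apply: sq_cvg_le (synth_cvg fs cM) _ => n.
exact: le_trans (sq_lincomb _ _ _ fs) (cM n).
Qed.

Lemma square_summable_bessel f x : suborthonormal f ->
  square_summable (fun n => dot x (f n)) (sq x).
Proof. by move=> fs n; apply: bessel. Qed.

Lemma square_summable_scaled f x (a : nat -> C) A : 0 <= A -> suborthonormal f ->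
  (forall n, csq (a n) <= A) ->
  square_summable (fun n => a n * dot x (f n)) (A * sq x).
Proof.
move=> A0 fs aA n; apply: le_trans (_ : A * series (fun k => csq (dot x (f k))) n <= _).
  rewrite /series /= mulr_sumr; apply: ler_sum => k _.
  by rewrite csqM ler_wpM2r // csq_ge0.
by rewrite ler_wpM2l // bessel.
Qed.

Lemma dot_eq0_l x : (forall y, dot x y = 0) -> x = 0.
Proof. by move=> /(_ x) /eqP; rewrite dnorm_eq0 => /eqP. Qed.

Section Basis.
Variable e : nat -> H.
Hypothesis eb : orthonormal_basis dot e.

Let eo : orthonormal_seq dot e. Proof. by case: eb. Qed.
Let es := orthonormal_suborthonormal eo.

Lemma basis_ext x y : (forall n, dot x (e n) = dot y (e n)) -> x = y.
Proof.
move=> h; apply/eqP; rewrite -subr_eq0; apply/eqP; apply: (proj2 eb) => n.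
by rewrite linearBl /= h subrr.
Qed.

Lemma basis_expansion x : synth e (fun n => dot x (e n)) = x.
Proof.
by apply: basis_ext => n; apply: synth_coef eo (square_summable_bessel x es).
Qed.

Lemma basis_expansion_cvg x : series (fun n => dot x (e n) *: e n) @ \oo --> x.
Proof.
by rewrite -[X in _ --> X]basis_expansion; apply: synth_cvg es (square_summable_bessel x es).
Qed.

Lemma sq_partial x n : sq (series (fun k => dot x (e k) *: e k) n) =
  series (fun k => csq (dot x (e k))) n.
Proof.
rewrite /series /= sq_sumo; last by move=> i j /negPf ij; rewrite dotZl dotZr eo ij !mulr0.
apply: eq_bigr => k _; rewrite sqZ.
suff -> : sq (e k) = 1 by rewrite mulr1.
by apply: (@complexI R); rewrite sqE eo eqxx.
Qed.

Lemma parseval x : series (fun k => csq (dot x (e k))) @ \oo --> sq x.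
Proof.
have v := sq_cvg (@basis_expansion_cvg x).
apply/cvgrPdist_le => d d0; have [N hN] := v _ d0.
by exists N => // n /hN; rewrite sq_partial distrC.
Qed.

Lemma basis_sq_le x M : (forall n, series (fun k => csq (dot x (e k))) n <= M) -> sq x <= M.
Proof.
by move=> h; apply: sq_cvg_le (@basis_expansion_cvg x) _ => n; rewrite sq_partial.
Qed.

End Basis.

End HilbertSpace.

(** * Bounded operators, adjoints, and diagonal operators inside an ideal *)

Section BoundedOperators.
Variables (R : realType) (H : completeNormedModType R[i]).
Variable dot : {dot H for Num.conj}.
Hypothesis Hn : hilbert_norm dot.
Local Notation C := R[i].
Local Notation sq := (sq dot).
Implicit Types (x y z : H) (a b : C) (A B : H -> H).

Lemma linear_op0 A : linear A -> A 0 = 0.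
Proof. by move=> l; have /eqP := l 1 0 0; rewrite scale1r addr0 scale1r -{1}[A 0]addr0 (inj_eq (addrI _)) eq_sym => /eqP. Qed.

Lemma linear_opZ A a x : linear A -> A (a *: x) = a *: A x.
Proof. by move=> l; rewrite -[a *: x]addr0 l linear_op0 // addr0. Qed.

Lemma linear_opD A x y : linear A -> A (x + y) = A x + A y.
Proof. by move=> l; have := l 1 x y; rewrite !scale1r. Qed.

Lemma linear_opB A x y : linear A -> A (x - y) = A x - A y.
Proof. by move=> l; rewrite linear_opD // -scaleN1r linear_opZ // scaleN1r. Qed.

Lemma linear_op_series A (u : nat -> H) n : linear A ->
  A (series u n) = series (fun k => A (u k)) n.
Proof.
move=> l; rewrite /series /=; elim: n => [|n IH]; first by rewrite !big_geq // linear_op0.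
by rewrite !big_nat_recr //= linear_opD // IH.
Qed.

Lemma bounded_opP A :
  bounded_op A <-> linear A /\ exists2 K, 0 <= K & forall x, sq (A x) <= K * sq x.
Proof.
split=> [[l c]|[l [K K0 AK]]]; split => //.
  have /cvgrPdist_le /(_ 1 ltr01) := c 0.
  move=> /nbhs_ballP [d /= d0 hd].
  have dr : d \is Num.real by apply: gtr0_real.
  (* Half the radius puts the closed r-ball inside the open d-ball; homogeneity then gives the
     constant 1 / r^2. *)
  pose r := complex.Re d / 2.
  have r0 : 0 < r by rewrite divr_gt0 // -ltcR RRe_real.
  have small y : sq y <= r ^+ 2 -> sq (A y) <= 1.
    move=> yr; have : ball (0 : H) d y.
      rewrite -ball_normE /= sub0r normrN.
      apply: (@le_lt_trans _ _ r%:C%C); first by rewrite (norm_le_sq Hn) // ltW.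
      by rewrite -(RRe_real dr) ltcR /r ltr_pdivrMr // ltr_pMr ?ltr1n // -ltcR RRe_real.
    move=> /hd /=; rewrite linear_op0 // sub0r normrN.
    by rewrite -[1]/(1%:C%C) (norm_le_sq Hn) // expr1n.
  exists (r ^+ 2)^-1; first by rewrite invr_ge0 sqr_ge0.
  move=> x; have [x0|x0] := eqVneq (sq x) 0.
    by rewrite (sq_eq0 x0) linear_op0 // sq0 mulr0.
  have xp : 0 < sq x by rewrite lt_neqAle eq_sym x0 sq_ge0.
  pose t : R := r / Num.sqrt (sq x).
  have t2 : t ^+ 2 = r ^+ 2 / sq x by rewrite exprMn exprVn sqr_sqrtr // ltW.
  have := small (t%:C%C *: x).
  rewrite linear_opZ // !sqZ csq_real t2 divfK // => /(_ (lexx _)).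
  rewrite mulrAC ler_pdivrMr // mul1r => h.
  by rewrite mulrC ler_pdivlMr ?exprn_gt0 // mulrC.
move=> x; apply/cvgrPdist_le => e e0.
have er : e \is Num.real by apply: gtr0_real.
have e'0 : 0 < complex.Re e by rewrite -ltcR RRe_real.
have K1 : 0 < K + 1 by rewrite ltr_wpDl.
pose d := complex.Re e / Num.sqrt (K + 1).
have d0 : 0 < d by rewrite divr_gt0 // sqrtr_gt0.
have d0C : 0 < d%:C%C by rewrite ltcR.
near=> y.
have : `|x - y| <= d%:C%C by near: y; apply: cvgr_dist_le.
rewrite -linear_opB // -(RRe_real er) !(norm_le_sq Hn) ?(ltW e'0) ?(ltW d0) // => h.
apply: le_trans (AK _) _; apply: (@le_trans _ _ (K * d ^+ 2)); first by rewrite ler_wpM2l.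
rewrite exprMn exprVn sqr_sqrtr ?(ltW K1) // mulrA ler_pdivrMr // mulrC.
by rewrite ler_wpM2l ?sqr_ge0 // lerDl.
Unshelve. all: by end_near. Qed.

Lemma bounded_op_cvg A (u : nat -> H) l : bounded_op A -> u @ \oo --> l ->
  (fun n => A (u n)) @ \oo --> A l.
Proof.
move=> [_ Ac] ul; apply: (cvg_comp _ _ ul); exact: Ac.
Qed.

Lemma bounded_op_comp A B : bounded_op A -> bounded_op B -> bounded_op (A \o B).
Proof.
move=> /bounded_opP [lA [K K0 hA]] /bounded_opP [lB [L L0 hB]]; apply/bounded_opP; split.
  by move=> a x y /=; rewrite lB lA.
exists (K * L); first exact: mulr_ge0.
by move=> x /=; apply: le_trans (hA _) _; rewrite -mulrA ler_wpM2l.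
Qed.

Lemma bounded_op_id : bounded_op (id : H -> H).
Proof. by apply/bounded_opP; split => //; exists 1 => // x; rewrite mul1r. Qed.

Lemma adjoint_linear A B : (forall x y, dot (A x) y = dot x (B y)) -> linear A.
Proof.
move=> AB a x y; apply/eqP; rewrite -subr_eq0; apply/eqP; apply: (@dot_eq0_l _ _ dot) => z.
by rewrite linearBl /= !linearDl /= !dotZl !AB linearDl /= dotZl subrr.
Qed.

Lemma adjoint_swap A B : (forall x y, dot (A x) y = dot x (B y)) ->
  forall x y, dot (B x) y = dot x (A y).
Proof. by move=> AB x y; rewrite dotC -AB -dotC. Qed.

Lemma adjoint_uniq A B : (forall x y, dot (A x) y = dot x (B y)) -> adjoint dot A = B.
Proof.
move=> AB; rewrite /adjoint.
have /(@xgetPex _ (fun=> 0)) /= h : exists B', [set B : H -> H | forall x y, dot (A x) y = dot x (B y)] B'.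
  by exists B.
apply/funext => y; apply/eqP; rewrite -subr_eq0; apply/eqP; apply: (@dot_eq0_l _ _ dot) => x.
by rewrite dotC linearBr /= -h -AB subrr conjC0.
Qed.

Lemma adjoint_bound A B K : 0 <= K -> (forall x y, dot (A x) y = dot x (B y)) ->
  (forall x, sq (A x) <= K * sq x) -> forall y, sq (B y) <= K * sq y.
Proof.
move=> K0 AB AK y; have [->|y0] := eqVneq (sq (B y)) 0; first by rewrite mulr_ge0 // sq_ge0.
have p : 0 < sq (B y) by rewrite lt_neqAle eq_sym y0 sq_ge0.
rewrite -(ler_pM2r p) -expr2 -csq_real sqE -AB.
apply: le_trans (cauchy_schwarz _ _ _) _.
by rewrite mulrAC ler_wpM2r // sq_ge0.
Qed.

Lemma vanishes_eq (a b : C) (s : nat -> C) : vanishes (fun n => csq (a - s n)) ->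
  vanishes (fun n => csq (b - s n)) -> a = b.
Proof.
move=> va vb; apply/eqP; rewrite -subr_eq0; apply/eqP; apply: vanishes_csq.
apply: vanishes_le (vanishesD (vanishesZ (ler0n _ 2) va) (vanishesZ (ler0n _ 2) vb)) => n.
by rewrite [csq (b - _)]csqB; apply: le_trans (csqD _ _); rewrite addrA subrK.
Qed.

(* diag_op rho is, by conversion, the case f = g = e. *)
Definition schmidt (a : nat -> C) (f g : nat -> H) : H -> H :=
  fun x => synth f (fun n => a n * dot x (g n)).

(** Both inner products are limits of the same finite sums, up to a conjugation. *)
Lemma schmidt_adjoint (a : nat -> C) K f g : 0 <= K -> (forall n, csq (a n) <= K) ->
  suborthonormal dot f -> suborthonormal dot g ->
  forall x y, dot (schmidt a f g x) y = dot x (schmidt (fun n => (a n)^*) g f y).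
Proof.
move=> K0 aK fs gs x y.
have aK' n : csq (a n)^* <= K by rewrite csq_conj.
rewrite [RHS]dotC.
have v := synth_dot Hn y fs (square_summable_scaled x K0 gs aK).
have w := synth_dot Hn x gs (square_summable_scaled y K0 fs aK').
apply: (vanishes_eq v); apply: vanishes_le w => n.
rewrite -csq_conj rmorphB /= conjCK le_eqVlt; apply/orP; left; apply/eqP; congr (csq (_ - _)).
rewrite rmorph_sum /=; apply: eq_bigr => k _.
by rewrite !rmorphM /= -!dotC mulrAC.
Qed.

Lemma schmidt_le (a : nat -> C) K f g x : 0 <= K -> (forall n, csq (a n) <= K) ->
  suborthonormal dot f -> suborthonormal dot g -> sq (schmidt a f g x) <= K * sq x.
Proof.
move=> K0 aK fs gs; apply: (sq_synth_le Hn fs).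
exact: square_summable_scaled.
Qed.

Lemma schmidt_bounded (a : nat -> C) K f g : 0 <= K -> (forall n, csq (a n) <= K) ->
  suborthonormal dot f -> suborthonormal dot g -> bounded_op (schmidt a f g).
Proof.
move=> K0 aK fs gs; apply/bounded_opP; split.
  exact: adjoint_linear (schmidt_adjoint K0 aK fs gs).
by exists K => // x; apply: schmidt_le.
Qed.

Section WithBasis.
Variable e : nat -> H.
Hypothesis eb : orthonormal_basis dot e.
Let eo : orthonormal_seq dot e. Proof. by case: eb. Qed.
Let es := orthonormal_suborthonormal eo.

(** The adjoint is built as B y, the sum of the <y, A e_n> e_n. Its coefficients are square
    summable: testing A on the partial sum z gives <A z, y> = s, whence s^2 <= K s |y|^2. *)
Lemma adjointP A : bounded_op A -> forall x y, dot (A x) y = dot x (adjoint dot A y).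
Proof.
move=> bA; have /bounded_opP [l [K K0 AK]] := bA.
pose B y := synth e (fun n => dot y (A (e n))).
suff h : forall x y, dot (A x) y = dot x (B y) by rewrite (adjoint_uniq h).
have ss y : square_summable (fun n => dot y (A (e n))) (K * sq y).
  move=> n; set s := series _ n; pose c k := dot y (A (e k)).
  have s0 : 0 <= s by rewrite sumr_ge0 // => k _; apply: csq_ge0.
  have [->|sn0] := eqVneq s 0; first by rewrite mulr_ge0 // sq_ge0.
  have sp : 0 < s by rewrite lt_neqAle eq_sym sn0.
  pose z := series (fun k => c k *: e k) n.
  have zs : sq z <= s by apply: sq_lincomb.
  have yz : dot (A z) y = s%:C%C.
    rewrite linear_op_series // /series /= linear_sumlz rmorph_sum /=.
    apply: eq_bigr => k _; rewrite linear_opZ // csq_conjE.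
    by rewrite [X in _ = _ * X](_ : _ = dot (A (e k)) y) -?dotC //; exact: dotZl.
  rewrite -(ler_pM2r sp) -expr2 -csq_real -yz.
  apply: le_trans (cauchy_schwarz _ _ _) _; rewrite mulrAC ler_wpM2r ?sq_ge0 //.
  by apply: le_trans (AK _) _; rewrite ler_wpM2l.
move=> x y; rewrite [RHS]dotC.
have v := dot_cvg_l Hn y (bounded_op_cvg bA (@basis_expansion_cvg _ _ _ Hn _ eb x)).
have w := synth_dot Hn x es (ss y).
apply: (vanishes_eq (s := fun n => \sum_(0 <= k < n) dot x (e k) * dot (A (e k)) y)).
  apply: vanishes_le v => n; rewrite csqB le_eqVlt; apply/orP; left; apply/eqP; congr (csq (_ - _)).
  rewrite linear_op_series // /series /= linear_sumlz; apply: eq_bigr => k _.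
  by rewrite linear_opZ //; exact: esym (dotZl _ _ _ _).
apply: vanishes_le w => n.
rewrite -csq_conj rmorphB /= conjCK le_eqVlt; apply/orP; left; apply/eqP; congr (csq (_ - _)).
rewrite rmorph_sum /=; apply: eq_bigr => k _.
by rewrite rmorphM /= -!dotC mulrC.
Qed.

Lemma adjoint_bounded A : bounded_op A -> bounded_op (adjoint dot A).
Proof.
move=> bA; have /bounded_opP [l [K K0 AK]] := bA; apply/bounded_opP; split.
  exact: adjoint_linear (adjoint_swap (adjointP bA)).
by exists K => //; exact: adjoint_bound (adjointP bA) AK.
Qed.

Lemma diag_schmidt rho : diag_op dot e rho = schmidt rho e e.
Proof. by []. Qed.

Lemma schmidt_coef (a : nat -> C) K f x i : 0 <= K -> (forall n, csq (a n) <= K) ->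
  suborthonormal dot f -> dot (schmidt a e f x) (e i) = a i * dot x (f i).
Proof.
by move=> K0 aK fs; apply: (synth_coef Hn i eo (square_summable_scaled x K0 fs aK)).
Qed.

Lemma c0star_csq (s : R^nat) n : c0star s -> csq ((s n)%:C%C) <= (s 0%N) ^+ 2.
Proof.
move=> [s0 sd _]; rewrite csq_real ler_pXn2r ?nnegrE //.
exact: sd.
Qed.

Lemma diag_seq_coef s x i : c0star s ->
  dot (diag_seq dot e s x) (e i) = (s i)%:C%C * dot x (e i).
Proof. by move=> sc; apply: (schmidt_coef _ _ (sqr_ge0 _) (fun n => c0star_csq n sc)). Qed.

Lemma diag_seq_bounded s : c0star s -> bounded_op (diag_seq dot e s).
Proof. by move=> sc; apply: (schmidt_bounded (sqr_ge0 _) (fun n => c0star_csq n sc)). Qed.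

Lemma diag_seq_adjoint s : c0star s -> adjoint dot (diag_seq dot e s) = diag_seq dot e s.
Proof.
move=> sc; apply: adjoint_uniq => x y.
rewrite (schmidt_adjoint (sqr_ge0 _) (fun n => c0star_csq n sc) es es).
congr (dot x _); rewrite /diag_seq diag_schmidt; congr (schmidt _ e e y).
by apply/funext => n; apply: conj_Creal; apply/complex_realP; exists (s n).
Qed.

Lemma diag_seq_basis s n : c0star s -> diag_seq dot e s (e n) = (s n)%:C%C *: e n.
Proof.
move=> sc; apply: (basis_ext eb) => k; rewrite diag_seq_coef // dotZl eo.
by have [->|] := eqVneq n k; rewrite ?mulr0.
Qed.

Lemma diag_seq_singular s : c0star s -> singular_numbers dot (diag_seq dot e s) s.
Proof.
move=> sc; split => //; exists e; split => // [n|x xe].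
  rewrite diag_seq_adjoint // diag_seq_basis //.
  rewrite (linear_opZ _ _ (proj1 (diag_seq_bounded sc))) diag_seq_basis // scalerA.
  by rewrite rmorphXn /= expr2.
by rewrite (proj2 eb _ xe) (linear_op0 (proj1 (diag_seq_bounded sc))).
Qed.

Lemma singular_gram X s f i j : bounded_op X ->
  orthonormal_seq dot f ->
  (forall n, adjoint dot X (X (f n)) = ((s n) ^+ 2)%:C%C *: f n) ->
  dot (X (f i)) (X (f j)) = if i == j then ((s i) ^+ 2)%:C%C else 0.
Proof.
move=> bX fo fX; rewrite adjointP // fX dotZr fo.
case: eqVneq => [->|_]; rewrite ?mulr0 // mulr1.
by apply: conj_Creal; apply/complex_realP; exists (s j ^+ 2).
Qed.

(** V sends e_n to f_n and W reads coordinates along g_n = X f_n / s_n, so W X V = diag(s); this is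
    the polar decomposition in coordinates. *)
Lemma ideal_diag_singular I X s : operator_ideal I -> I X -> singular_numbers dot X s ->
  I (diag_seq dot e s).
Proof.
move=> Iid IX [sc [f [fo fX _]]].
have [bX _] := ideal_compact Iid IX.
have fs := orthonormal_suborthonormal fo.
(* The inverse of 0 is 0, so g n = 0 whenever s n = 0; for this reason g is only
   [suborthonormal]. *)
pose g n := ((s n)^-1)%:C%C *: X (f n).
have gram := singular_gram _ _ bX fo fX.
have realc (r : R) : (r%:C%C)^* = r%:C%C.
  by apply: conj_Creal; apply/complex_realP; exists r.
have gs : suborthonormal dot g.
  split=> [i j ij|i]; first by rewrite /g dotZl dotZr gram (negPf ij) !mulr0.
  rewrite -lecR sqE /g dotZl dotZr gram eqxx realc -!rmorphM /= lecR.
  have [->|si] := eqVneq (s i) 0; first by rewrite invr0 !mul0r ler01.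
  by rewrite expr2 mulKf // mulVf.
have c1 (n : nat) : csq (1 : C) <= 1 by rewrite /csq /= expr1n expr0n addr0.
pose V := schmidt (fun=> 1) f e; pose W := schmidt (fun=> 1) e g.
have bV : bounded_op V by apply: (schmidt_bounded ler01 c1).
have bW : bounded_op W by apply: (schmidt_bounded ler01 c1).
have -> : diag_seq dot e s = W \o X \o V.
  apply/funext => x /=; apply: (basis_ext eb) => i.
  rewrite diag_seq_coef // (schmidt_coef _ _ ler01 c1 gs) mul1r /g dotZr realc.
  rewrite adjointP // fX dotZr realc mulrA -rmorphM /=.
  have -> : dot (V x) (f i) = dot x (e i).
    rewrite /V (synth_coef Hn i fo (square_summable_scaled x ler01 es c1)) mul1r //.
  have [->|si] := eqVneq (s i) 0; first by rewrite invr0 !mul0r.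
  by rewrite expr2 mulKf.
exact: ideal_mul.
Qed.

Lemma charsetP I s : operator_ideal I ->
  charset dot I s <-> c0star s /\ I (diag_seq dot e s).
Proof.
move=> Iid; split=> [[X IX sX]|[sc Is]].
  by split; [case: sX | exact: ideal_diag_singular sX].
by exists (diag_seq dot e s) => //; apply: diag_seq_singular.
Qed.

Lemma charset_hereditary I xi eta K : operator_ideal I -> c0star xi ->
  charset dot I eta -> (forall n, xi n <= K * eta n) -> charset dot I xi.
Proof.
move=> Iid xic /(charsetP _ Iid) [ec Ie] xe; apply/(charsetP _ Iid); split => //.
have [e0 _ _] := ec; have [x0 _ _] := xic.
(* diag(xi) is diag(eta) times the bounded diagonal of these ratios. Where eta n = 0 the quotient is
   0, which is consistent since xi n = 0 there. *)
pose r n := ((xi n / eta n)%:C%C).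
have rK n : csq (r n) <= K ^+ 2.
  rewrite csq_real; have [->|en] := eqVneq (eta n) 0.
    by rewrite invr0 mulr0 expr0n sqr_ge0.
  have ep : 0 < eta n by rewrite lt_neqAle eq_sym en e0.
  have h : xi n / eta n <= K by rewrite ler_pdivrMr.
  by rewrite ler_pXn2r ?nnegrE ?divr_ge0 // (le_trans _ h) // divr_ge0.
pose D := schmidt r e e.
have bD : bounded_op D by apply: (schmidt_bounded (sqr_ge0 _) rK).
have -> : diag_seq dot e xi = D \o diag_seq dot e eta \o id.
  apply/funext => x /=; apply: (basis_ext eb) => i.
  rewrite diag_seq_coef // (schmidt_coef _ _ (sqr_ge0 _) rK es) diag_seq_coef // mulrA.
  rewrite -rmorphM /=; have [ei|en] := eqVneq (eta i) 0; last by rewrite divfK.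
  have -> : xi i = 0 by apply/eqP; rewrite eq_le x0 andbT (le_trans (xe i)) // ei mulr0.
  by rewrite !mul0r.
by apply: ideal_mul => //; exact: bounded_op_id.
Qed.

End WithBasis.
End BoundedOperators.

(** * Uniqueness of singular numbers and compactness of diagonal operators *)

Section SingularNumbers.
Variables (R : realType) (H : completeNormedModType R[i]).
Variable dot : {dot H for Num.conj}.
Hypothesis Hn : hilbert_norm dot.
Local Notation C := R[i].
Local Notation sq := (sq dot).
Implicit Types (x y z : H) (a b : C) (A B X : H -> H).
Variable e : nat -> H.
Hypothesis eb : orthonormal_basis dot e.
Let eo : orthonormal_seq dot e. Proof. by case: eb. Qed.
Let es := orthonormal_suborthonormal eo.

(** There are n + 1 unknowns and n linear equations: a matrix with more rows than columns has a
    nonzero left kernel. *)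
Lemma exists_orthogonal_combination (f f' : nat -> H) n :
  exists c : nat -> C, (exists2 k, (k <= n)%N & c k != 0) /\
    forall j, (j < n)%N -> dot (series (fun k => c k *: f k) n.+1) (f' j) = 0.
Proof.
pose M : 'M[C]_(n.+1, n) := \matrix_(k, j) dot (f k) (f' j).
have /rowV0Pn [v /sub_kermxP vM v0] : kermx M != 0.
  rewrite -mxrank_eq0 mxrank_ker -lt0n subn_gt0.
  exact: leq_ltn_trans (rank_leq_col M) (ltnSn n).
exists (fun k => v 0 (inord k)); split.
  have [/existsP[k hk]|] := boolP [exists k, v 0 k != 0].
    by exists k; rewrite ?inord_val // -ltnS.
  rewrite negb_exists => /forallP h; case/eqP: v0; apply/rowP => k.
  by have := h k; rewrite negbK => /eqP ->; rewrite mxE.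
move=> j jn; have /rowP/(_ (Ordinal jn)) := vM.
rewrite mxE [RHS]mxE => <-; rewrite dot_sum_l big_mkord; apply: eq_bigr => k _.
by rewrite !mxE inord_val.
Qed.

Lemma sq_singular_series X (s : R^nat) f (c : nat -> C) n :
  bounded_op X -> orthonormal_seq dot f ->
  (forall n, adjoint dot X (X (f n)) = ((s n) ^+ 2)%:C%C *: f n) ->
  sq (X (series (fun k => c k *: f k) n)) =
  \sum_(0 <= k < n) csq (c k) * s k ^+ 2.
Proof.
move=> bX fo fX; have [lX _] := bX.
have gram := singular_gram Hn eb _ _ bX fo fX.
rewrite linear_op_series // /series /= sq_sumo; last first.
  by move=> i j /negPf ij; rewrite !linear_opZ // dotZl dotZr gram ij !mulr0.
apply: eq_bigr => k _; rewrite linear_opZ // sqZ; congr (_ * _).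
by apply: (@complexI R); rewrite sqE gram eqxx.
Qed.

(** Half of the min-max principle: a nonzero x in the span of f_0, ..., f_n and orthogonal to the
    first n vectors f' satisfies s_n |x| <= |X x| <= s'_n |x|. *)
Lemma singular_numbers_le X s s' n : bounded_op X -> singular_numbers dot X s ->
  singular_numbers dot X s' -> s n <= s' n.
Proof.
move=> bX [[s0 sd _] [f [fo fX _]]] [[s'0 s'd _] [f' [fo' fX' f'0]]].
have [c [[k0 k0n ck0] corth]] := exists_orthogonal_combination f f' n.
set x := series _ _ in corth.
have lX := proj1 bX.
have fs' := orthonormal_suborthonormal fo'.
have xE : sq x = \sum_(0 <= k < n.+1) csq (c k).
  rewrite /x /series /= sq_sumo; last by move=> i j /negPf ij; rewrite dotZl dotZr fo ij !mulr0.
  apply: eq_bigr => k _; rewrite sqZ.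
  suff -> : sq (f k) = 1 by rewrite mulr1.
  by apply: (@complexI R); rewrite sqE fo eqxx.
have xp : 0 < sq x.
  rewrite xE (bigD1_seq k0) ?iota_uniq ?mem_index_iota //=.
  rewrite ltr_wpDr //; first by rewrite sumr_ge0 // => k _; exact: csq_ge0.
  rewrite lt_neqAle csq_ge0 andbT; apply: contra ck0 => /eqP h.
  by rewrite (csq_eq0 (esym h)).
have lower : s n ^+ 2 * sq x <= sq (X x).
  rewrite (sq_singular_series _ _ bX fo fX) xE mulr_sumr big_nat_cond [leRHS]big_nat_cond.
  apply: ler_sum => k /andP[/andP[_ kn] _]; rewrite mulrC ler_wpM2l ?csq_ge0 //.
  by rewrite ler_pXn2r ?nnegrE //; apply: sd.
have upper : sq (X x) <= s' n ^+ 2 * sq x.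
  pose d k := dot x (f' k).
  have dss : square_summable d (sq x) by apply: square_summable_bessel.
  (* X kills the part of x orthogonal to every f', so only the expansion of x along f' counts. *)
  have -> : X x = X (synth f' d).
    apply/eqP; rewrite -subr_eq0 -linear_opB //; apply/eqP; apply: f'0 => j.
    by rewrite linearBl /= (synth_coef Hn j fo' dss) subrr.
  have cv := bounded_op_cvg bX (synth_cvg Hn fs' dss).
  apply: (sq_cvg_le Hn cv) => N; rewrite (sq_singular_series _ _ bX fo' fX').
  apply: le_trans (_ : s' n ^+ 2 * series (fun k => csq (d k)) N <= _); last first.
    by rewrite ler_wpM2l ?sqr_ge0.
  rewrite /series /= mulr_sumr; apply: ler_sum => k _.
  have [kn|nk] := ltnP k n; first by rewrite /d corth // csq0 mul0r mulr0.
  rewrite mulrC ler_wpM2r ?csq_ge0 // ler_pXn2r ?nnegrE //; exact: s'd.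
have := le_trans lower upper.
by rewrite ler_pM2r // ler_pXn2r ?nnegrE.
Qed.

Lemma singular_numbers_uniq X s s' : bounded_op X -> singular_numbers dot X s ->
  singular_numbers dot X s' -> s = s'.
Proof.
by move=> bX h h'; apply/funext => n; apply/eqP; rewrite eq_le !(singular_numbers_le _ bX).
Qed.

Lemma diag_seq_tail s x M n : c0star s -> sq x <= 1 ->
  \sum_(M <= k < n) csq (dot (diag_seq dot e s x) (e k)) <= s M ^+ 2.
Proof.
move=> sc x1; have [s0 sd _] := sc.
apply: le_trans (_ : s M ^+ 2 * \sum_(M <= k < n) csq (dot x (e k)) <= _).
  rewrite mulr_sumr big_nat_cond [leRHS]big_nat_cond.
  apply: ler_sum => k /andP[/andP[Mk _] _].
  rewrite (diag_seq_coef Hn eb) // csqM csq_real ler_wpM2r ?csq_ge0 //.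
  by rewrite ler_pXn2r ?nnegrE //; exact: sd.
rewrite ler_piMr ?sqr_ge0 //; apply: le_trans x1.
apply: (@le_trans _ _ (series (fun k => csq (dot x (e k))) n)); last exact: bessel.
have [Mn|/ltnW nM] := leqP M n; last by rewrite big_geq // sumr_ge0 // => k _; exact: csq_ge0.
rewrite /series /= (@big_cat_nat _ _ _ M 0 n) //= lerDr sumr_ge0 // => k _; exact: csq_ge0.
Qed.

Lemma closure_sq (S : set H) y (d : R) : 0 < d -> closure S y ->
  exists2 z, S z & sq (y - z) <= d.
Proof.
move=> d0 yS; have r0 : 0 < Num.sqrt d by rewrite sqrtr_gt0.
have r0C : 0 < (Num.sqrt d)%:C%C by rewrite ltcR.
have [z [Sz]] := yS _ (nbhsx_ballx y _ r0C).
rewrite -ball_normE /= => /ltW; rewrite (norm_le_sq Hn) ?sqrtr_ge0 // sqr_sqrtr ?(ltW d0) //.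
by exists z.
Qed.

(** The factor 2 comes from splitting y into z and y - z with [csqD]; it is harmless where q tends
    to 0 with M. *)
Lemma closure_tail (S : set H) (q : R) M :
  (forall x, S x -> forall n, \sum_(M <= k < n) csq (dot x (e k)) <= q) ->
  forall y, closure S y -> forall n, \sum_(M <= k < n) csq (dot y (e k)) <= 2 * q.
Proof.
move=> Sq y yS n; apply/ler_addgt0Pr => d d0.
have d2 : 0 < d / 2 by rewrite divr_gt0.
have [z Sz zy] := closure_sq d2 yS.
apply: le_trans (_ : \sum_(M <= k < n) (2 * csq (dot z (e k)) + 2 * csq (dot (y - z) (e k))) <= _).
  apply: ler_sum => k _; apply: le_trans (csqD _ _).
  by rewrite linearBl /= addrC subrK.
rewrite big_split /= -!mulr_sumr lerD ?ler_wpM2l ?Sq //.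
rewrite [leRHS](_ : d = 2 * (d / 2)); last by rewrite mulrC divfK.
rewrite ler_wpM2l //; apply: le_trans zy; apply: (@le_trans _ _ (series (fun k => csq (dot (y - z) (e k))) n)); last exact: bessel.
have [Mn|/ltnW nM] := leqP M n; last by rewrite big_geq // sumr_ge0 // => k _; exact: csq_ge0.
rewrite /series /= (@big_cat_nat _ _ _ M 0 n) //= lerDr sumr_ge0 // => k _; exact: csq_ge0.
Qed.

Lemma ultra_bounded_cvg (T : Type) (F : set_system T) (g : T -> R) (r : R) :
  UltraFilter F -> F [set t | `|g t| <= r] ->
  exists a0 : R, forall d : R, 0 < d -> F [set t | `|g t - a0| <= d].
Proof.
move=> UF Fr.
have Fg : F (g @^-1` `[- r, r]).
  by apply: filterS Fr => t /= h; rewrite in_itv /= -ler_norml.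
have [a [_ ca]] := @segment_compact R (- r) r (g @ F) _ Fg.
exists a => d d0; have [//|nF] := in_ultra_setVsetC [set t | `|g t - a| <= d] UF.
have gF : (g @ F) (~` [set v | `|v - a| <= d]) by [].
have nb : nbhs a [set v | `|v - a| <= d].
  by apply/nbhs_ballP; exists d => // v; rewrite -ball_normE /= distrC => /ltW.
by have [v [vn vb]] := ca _ _ gF nb.
Qed.

(** The image of the unit ball has bounded coordinates and uniformly small tails. An ultrafilter on
    its closure therefore converges in each coordinate, the tails make it Cauchy, and completeness
    gives the limit. *)
Lemma diag_seq_compact s : c0star s -> compact_op (diag_seq dot e s).
Proof.
move=> sc; split; first exact: (diag_seq_bounded Hn eb).
have [s0 sd _] := sc.
set S := _ @` _; have Stail M x n : closure S x ->
    \sum_(M <= k < n) csq (dot x (e k)) <= 2 * s M ^+ 2.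
  move=> cx; apply: closure_tail cx n => _ [z /= z1 <-] n; apply: diag_seq_tail => //.
  by move: z1; rewrite -[1]/(1%:C%C) (norm_le_sq Hn) // expr1n.
rewrite precompactE compact_ultra => F UF FS.
have coord k x : closure S x -> csq (dot x (e k)) <= 2 * s k ^+ 2.
  by move=> cx; have := Stail k x k.+1 cx; rewrite big_nat1.
have lim_coord k : exists a : C, forall d : R, 0 < d -> F [set x | csq (dot x (e k) - a) <= d].
  (* From u^2 <= w follows |u| <= w + 1, a bound free of square roots. *)
  pose r := 2 * s k ^+ 2 + 1.
  have bd (u : R) : u ^+ 2 <= 2 * s k ^+ 2 -> `|u| <= r.
    move=> h; rewrite -(@ler_pXn2r _ 2) ?nnegrE // ?real_normK ?num_real //; last first.
      by rewrite addr_ge0 // mulr_ge0 // sqr_ge0.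
    apply: le_trans h _; rewrite /r.
    have : 0 <= 2 * s k ^+ 2 by rewrite mulr_ge0 // sqr_ge0.
    move: (2 * _) => w w0; rewrite sqrrD expr1n mulr1; have := sqr_ge0 w.
    by rewrite -mulr_natr; move: (w ^+ 2) => w2; lra.
  have [ar har] : exists a : R, forall d : R, 0 < d -> F [set x | `|complex.Re (dot x (e k)) - a| <= d].
    apply: (ultra_bounded_cvg (r := r)) => //; apply: filterS FS => x /(coord k) h; apply: bd.
    by apply: le_trans h; rewrite lerDl sqr_ge0.
  have [ai hai] : exists a : R, forall d : R, 0 < d -> F [set x | `|complex.Im (dot x (e k)) - a| <= d].
    apply: (ultra_bounded_cvg (r := r)) => //; apply: filterS FS => x /(coord k) h; apply: bd.
    by apply: le_trans h; rewrite lerDr sqr_ge0.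
  exists (Complex ar ai) => d d0.
  have d2 : 0 < Num.sqrt (d / 2) by rewrite sqrtr_gt0 divr_gt0.
  apply: filterS (filterI (har _ d2) (hai _ d2)) => x /= [].
  have E (u : R) : `|u| <= Num.sqrt (d / 2) -> u ^+ 2 <= d / 2.
    rewrite -(@ler_pXn2r _ 2) ?nnegrE ?sqrtr_ge0 // sqr_sqrtr ?divr_ge0 ?(ltW d0) //.
    by rewrite real_normK ?num_real.
  move=> /E h1 /E h2; rewrite [d]splitr; case: (dot x (e k)) h1 h2 => u v /= h1 h2.
  by rewrite /csq /= lerD.
have [a ha] := choice lim_coord.
have Fcauchy : cauchy F.
  apply: cauchy_exP => d d0.
  have dr : d \is Num.real by apply: gtr0_real.
  have d'0 : 0 < complex.Re d by rewrite -ltcR RRe_real.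
  pose r := complex.Re d / 2.
  have r0 : 0 < r by rewrite divr_gt0.
  have r4 : 0 < r / 2 by rewrite divr_gt0.
  have [M hM] := c0star_small sc r4.
  (* The centre carries the first M limit coordinates. The head of x - p costs at most r^2 / 2 and
     its tail at most 2 (r / 2)^2 = r^2 / 2. *)
  pose p := series (fun k => a k *: e k) M.
  exists p.
  have r2 : 0 < r ^+ 2 / 2 / M.+1%:R by rewrite !divr_gt0 // exprn_gt0.
  have FM m : F [set x | forall k, (k < m)%N -> csq (dot x (e k) - a k) <= r ^+ 2 / 2 / M.+1%:R].
    elim: m => [|m IH]; first by apply: filterS FS.
    apply: filterS (filterI IH (ha m _ r2)) => x /= [h1 h2] k.
    by rewrite ltnS leq_eqVlt => /orP[/eqP ->|/h1].
  apply: filterS (filterI FS (FM M)) => x [cx /= xa].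
  rewrite -ball_normE /= distrC; apply: (@le_lt_trans _ _ r%:C%C); last first.
    by rewrite -(RRe_real dr) ltcR /r ltr_pdivrMr // ltr_pMr ?ltr1n.
  rewrite (norm_le_sq Hn) ?(ltW r0) //; apply: (basis_sq_le Hn eb) => n.
  have pc k : dot p (e k) = if (k < M)%N then a k else 0.
    rewrite /p dot_sum_l; case: ltnP => kM.
      rewrite (bigD1_seq k) ?iota_uniq ?mem_index_iota //= eo eqxx mulr1 big1 ?addr0 //.
      by move=> j /negPf jk; rewrite eo jk mulr0.
    rewrite big_nat_cond big1 // => j /andP[/andP[_ jM] _]; rewrite eo ltn_eqF ?mulr0 //.
    exact: leq_trans jM kM.
  have dE k : csq (dot (x - p) (e k)) = if (k < M)%N then csq (dot x (e k) - a k) else csq (dot x (e k)).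
    by rewrite linearBl /= pc; case: ifP; rewrite ?subr0.
  apply: le_trans (_ : series (fun k => csq (dot (x - p) (e k))) (maxn M n) <= _).
    apply: series_mono => [k|]; [exact: csq_ge0 | exact: leq_maxr].
  rewrite /series /= (@big_cat_nat _ _ _ M 0) ?leq_maxl //= [leRHS]splitr lerD //.
    apply: le_trans (_ : \sum_(0 <= k < M) (r ^+ 2 / 2 / M.+1%:R) <= _).
      rewrite big_nat_cond [leRHS]big_nat_cond; apply: ler_sum => k /andP[/andP[_ kM] _].
      by rewrite dE kM xa.
    rewrite -[leLHS]/(series (fun=> r ^+ 2 / 2 / M.+1%:R) M) series_const mulrAC ler_pdivrMr //.
    by rewrite ler_wpM2l ?ler_nat // divr_ge0 // sqr_ge0.
  rewrite (eq_big_nat _ _ (F2 := fun k => csq (dot x (e k)))); last first.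
    by move=> k /andP[Mk _]; rewrite dE ltnNge Mk.
  apply: le_trans (Stail _ _ _ cx) _.
  apply: (@le_trans _ _ (2 * (r / 2) ^+ 2)).
    by rewrite ler_wpM2l // ler_pXn2r ?nnegrE ?(ltW r4) // hM.
  by rewrite le_eqVlt; apply/orP; left; apply/eqP; field.
have /cvg_ex [p Fp] : cvg F by apply: cauchy_cvg.
exists p; split => //=.
by apply: (@closed_closure _ S) => B /Fp FB; exact: filter_ex (filterI FS FB).
Qed.

(** Uniqueness of singular numbers gives one direction, compactness of diagonal operators the other.
    S is arbitrary, so the characteristic sets of [am_ideal] and [am_closure] can be read off before
    either is known to be an ideal. *)
Lemma charset_of_charset (S : set R^nat) s : (forall s, S s -> c0star s) ->
  charset dot (ideal_of_charset dot S) s <-> S s.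
Proof.
move=> Sc; split=> [[X [[bX _] [s' Ss' sX']] sX]|Ss].
  by rewrite (singular_numbers_uniq bX sX sX').
have sc := Sc _ Ss.
exists (diag_seq dot e s); last exact: (diag_seq_singular Hn eb).
split; first exact: diag_seq_compact.
by exists s => //; exact: (diag_seq_singular Hn eb).
Qed.

End SingularNumbers.

(** * Majorization, arithmetic means and substochastic matrices *)

Section RealMajorization.
Variable R : realType.
Implicit Types (x y z xi eta : R^nat) (P : nat -> nat -> R).

Lemma eneseries_le1 x : (forall n, 0 <= x n) ->
  (\sum_(0 <= j <oo) (x j)%:E <= 1)%E <-> forall n, series x n <= 1.
Proof.
move=> x0; split=> [h n|h].
  rewrite -lee_fin /series /= -sumEFin; apply: le_trans h.
  by apply: nneseries_lim_ge => k _ _; rewrite lee_fin.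
apply: lime_le; first by apply: is_cvg_nneseries => k _ _; rewrite lee_fin.
by near=> n; rewrite sumEFin lee_fin; apply: h.
Unshelve. all: by end_near. Qed.

Lemma arithmetic_mean_c0star xi : c0star xi -> c0star (arithmetic_mean xi).
Proof.
move=> [x0 xd xc]; split.
- by move=> n; rewrite /arithmetic_mean /= mulr_ge0 ?invr_ge0 // series_ge0.
- apply/nonincreasing_seqP => n; rewrite /arithmetic_mean /= ler_pdivrMl // mulrCA.
  rewrite ler_pdivlMl // [series xi n.+2]seriesSr mulrDr -[n.+2%:R]natr1 mulrDl mul1r lerD2l.
  elim: n => [|n IH]; first by rewrite mul1r seriesSr series0n add0r xd.
  rewrite -natr1 mulrDl mul1r seriesSr lerD ?xd //.
  by apply: le_trans IH; rewrite ler_wpM2l ?xd.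
- exact: cesaro.
Qed.

(** The mean of index n involves the partial sum of length n + 1; the remaining length 0 is
    trivial. *)
Lemma majorized_arithmetic_mean xi eta :
  majorized xi eta <-> forall n, arithmetic_mean xi n <= arithmetic_mean eta n.
Proof.
split=> [h n|h [|n]]; first by rewrite /arithmetic_mean /= ler_wpM2l ?invr_ge0.
  by rewrite !series0n.
by have := h n; rewrite /arithmetic_mean /= ler_pM2l ?invr_gt0.
Qed.

Lemma c0starZ (k : R) xi : 0 <= k -> c0star xi -> c0star (fun n => k * xi n).
Proof.
move=> k0 [x0 xd xc]; split => [n||]; first exact: mulr_ge0.
  by apply/nonincreasing_seqP => n; rewrite ler_wpM2l ?xd.
by rewrite -(mulr0 k); apply: cvgM => //; apply: cvg_cst.
Qed.

Lemma mean_bigO_majorized xi eta : seq_bigO (arithmetic_mean xi) (arithmetic_mean eta) ->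
  exists2 k : R, 0 < k & majorized xi (fun n => k * eta n).
Proof.
move=> [M M0 h]; exists M => //; apply/majorized_arithmetic_mean => n.
apply: le_trans (h n) _; rewrite /arithmetic_mean /= mulrCA.
by rewrite /series /= -mulr_sumr.
Qed.

(** Subtract the threshold eta n from every entry: terms before n are nonnegative with weight at
    most 1, later ones are nonpositive, and a total weight at most n pays the threshold back. *)
Lemma weighted_series_le (c eta : R^nat) N n : (forall j, 0 <= c j <= 1) ->
  c0star eta -> series c N <= n%:R ->
  series (fun j => c j * eta j) N <= series eta n.
Proof.
move=> c01 [e0 ed _] cn.
have step : forall N, series (fun j => c j * (eta j - eta n)) N <=
    series (fun j => eta j - eta n) n.
  have neg : forall j, (n <= j)%N -> c j * (eta j - eta n) <= 0.
    move=> j nj; rewrite mulr_ge0_le0 ?subr_le0 ?ed //; by case/andP: (c01 j).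
  have small m : (m <= n)%N -> series (fun j => c j * (eta j - eta n)) m <=
      series (fun j => eta j - eta n) m.
    elim: m => [|m IH] mn; first by rewrite !series0n.
    rewrite !seriesSr lerD ?IH ?(ltnW mn) //; rewrite ler_piMl ?subr_ge0 ?ed ?(ltnW mn) //.
    by case/andP: (c01 m).
  move=> M; have [Mn|/ltnW nM] := leqP M n.
    apply: le_trans (small _ Mn) _.
    suff pos m : (M <= m)%N -> (m <= n)%N -> series (fun j => eta j - eta n) M <=
        series (fun j => eta j - eta n) m by apply: pos.
    elim: m => [|m IH]; first by rewrite leqn0 => /eqP ->.
    rewrite leq_eqVlt => /orP[/eqP -> //|]; rewrite ltnS => Mm mn.
    rewrite seriesSr (le_trans (IH Mm (ltnW mn))) //.
    by rewrite lerDl subr_ge0 ed // ltnW.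
  rewrite -(subnKC nM); elim: (M - n)%N => [|i IH]; first by rewrite addn0 small.
  by rewrite addnS seriesSr -[leRHS]addr0 lerD // neg // leq_addr.
have := step N; rewrite /series /=.
under eq_bigr do rewrite mulrBr; rewrite sumrB [X in _ <= X]sumrB -mulr_suml.
rewrite big_const_nat subn0 iter_addr_0 -[eta n *+ n]mulr_natl => h.
have : \sum_(0 <= i < N) c i * eta n <= n%:R * eta n by rewrite -mulr_suml ler_wpM2r.
rewrite -mulr_suml; lra.
Qed.

Lemma mxact_cvg P eta i : substochastic P -> c0star eta ->
  series (fun j => P i j * eta j) @ \oo --> mxact P eta i.
Proof.
move=> [P0 Pr _] [e0 ed _]; suff h : cvgn (series (fun j => P i j * eta j)) by [].
apply: nondecreasing_is_cvgn.
  by apply/nondecreasing_seqP => n; rewrite seriesSr lerDl mulr_ge0.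
exists (eta 0%N) => _ [n _ <-].
apply: (@le_trans _ _ (series (fun j => P i j * eta 0%N) n)).
  by apply: series_le => j; rewrite ler_wpM2l // ed.
rewrite /series /= -mulr_suml ler_piMl //.
by have /(eneseries_le1 (P0 i))/(_ n) := Pr i.
Qed.

(** Adding the first n rows produces weights: column sums bound each of them by 1 and row sums bound
    their total by n, so [weighted_series_le] applies. *)
Lemma substochastic_majorized P eta : substochastic P -> c0star eta ->
  majorized (mxact P eta) eta.
Proof.
move=> Ps ec n; have [P0 Pr Pc] := Ps.
have cv : (fun N => \sum_(0 <= i < n) series (fun j => P i j * eta j) N) @ \oo -->
    series (mxact P eta) n.
  elim: n => [|n IH].
    rewrite series0n (_ : (fun N => _) = fun=> 0); first exact: cvg_cst.
    by apply/funext => N; rewrite big_geq.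
  rewrite seriesSr (_ : (fun N => _) =
    (fun N => \sum_(0 <= i < n) series (fun j => P i j * eta j) N +
              series (fun j => P n j * eta j) N)).
    by apply: cvgD => //; apply: mxact_cvg.
  by apply/funext => N; rewrite big_nat_recr.
rewrite -(cvg_lim _ cv) //; apply: limr_le; first by apply: cvgP cv.
near=> N.
have -> : \sum_(0 <= i < n) series (fun j => P i j * eta j) N =
    series (fun j => (\sum_(0 <= i < n) P i j) * eta j) N.
  rewrite /series /= exchange_big /=; apply: eq_bigr => j _; by rewrite mulr_suml.
apply: weighted_series_le => //.
  move=> j; rewrite sumr_ge0 //=.
  by have /(eneseries_le1 (fun i => P0 i j))/(_ n) := Pc j.
rewrite /series /= exchange_big /=.
apply: (@le_trans _ _ (\sum_(0 <= i < n) (1 : R))).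
  by apply: ler_sum => i _; have /(eneseries_le1 (P0 i))/(_ N) := Pr i.
by rewrite big_const_nat subn0 iter_addr_0.
Unshelve. all: by end_near. Qed.

Lemma block_strongly_majorized xi eta : block_majorized xi eta -> strongly_majorized xi eta.
Proof.
move=> [maj [n [nmono ne]]]; split => //.
rewrite limn_einf_lim (_ : einfs _ = fun=> 0%E); first by rewrite lim_cst.
apply/funext => m; apply/eqP; rewrite eq_le; apply/andP; split.
  have nk k : (k <= n k)%N.
    by elim: k => // k IH; apply: leq_ltn_trans IH (nmono _ _ (ltnSn k)).
  apply: ereal_inf_lbound; exists (n m) => //=; by rewrite ne subrr.
by apply: le_ereal_inf_tmp => _ [k _ <-]; rewrite lee_fin subr_ge0.
Qed.

Lemma sum_strongly_majorized xi eta : majorized xi eta ->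
  (fun n => series eta n - series xi n) @ \oo --> (0 : R) -> strongly_majorized xi eta.
Proof.
move=> maj cv; split => //.
suff /cvg_limn_einf_sup [] : (fun n => (series eta n - series xi n)%:E) @ \oo --> 0%:E by [].
exact: cvg_comp cv _.
Qed.

End RealMajorization.

(** * Matrices of operators and the diagonal of a conjugated diagonal operator *)

Section OperatorMatrices.
Variables (R : realType) (H : completeNormedModType R[i]).
Variable dot : {dot H for Num.conj}.
Hypothesis Hn : hilbert_norm dot.
Local Notation C := R[i].
Local Notation sq := (sq dot).
Implicit Types (x y z : H) (a b : C) (A B L U X : H -> H).
Variable e : nat -> H.
Hypothesis eb : orthonormal_basis dot e.
Let eo : orthonormal_seq dot e. Proof. by case: eb. Qed.
Let es := orthonormal_suborthonormal eo.

(** Moduli make this a real matrix for every contraction; for real entries it is the entrywise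
    square. *)
Definition sqmx (A : H -> H) : nat -> nat -> R := fun i j => csq (entry dot e A i j).

Lemma conjC_realC (r : R) : (r%:C%C)^* = r%:C%C.
Proof. by apply: conj_Creal; apply/complex_realP; exists r. Qed.

Lemma sq_basis n : sq (e n) = 1.
Proof. by apply: (@complexI R); rewrite sqE eo eqxx. Qed.

Lemma sqmx_adjoint A i j : bounded_op A -> sqmx A i j = csq (dot (adjoint dot A (e i)) (e j)).
Proof.
by move=> bA; rewrite /sqmx /entry (adjointP Hn eb) // dotC csq_conj.
Qed.

(** Columns come from the coordinates of L e_j and rows from those of the adjoint applied to e_i;
    both vectors have norm at most 1, so Bessel's inequality bounds the sums. *)
Lemma contraction_substochastic L : bounded_op L -> (forall x, sq (L x) <= sq x) ->
  substochastic (sqmx L).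
Proof.
move=> bL L1.
have L0 i j : 0 <= sqmx L i j by apply: csq_ge0.
have ad1 x : sq (adjoint dot L x) <= sq x.
  have L1' y : sq (L y) <= 1 * sq y by rewrite mul1r.
  by rewrite -[leRHS]mul1r; exact: (adjoint_bound ler01 (adjointP Hn eb bL) L1').
split=> // i; apply/(eneseries_le1 _) => // n.
  rewrite (_ : sqmx L i = fun k => csq (dot (adjoint dot L (e i)) (e k))); last first.
    by apply/funext => k; rewrite sqmx_adjoint.
  apply: (@le_trans _ _ (sq (adjoint dot L (e i)))); last by rewrite -[leRHS](sq_basis i).
  exact: (bessel _ n es).
apply: (@le_trans _ _ (sq (L (e i)))); last by rewrite -[leRHS](sq_basis i).
exact: (bessel (L (e i)) n es).
Qed.

Lemma contraction_opP L : contraction_op L <-> bounded_op L /\ forall x, sq (L x) <= sq x.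
Proof.
have E x : (`|L x| <= `|x|) = (sq (L x) <= sq x).
  by rewrite -lecR !(sq_norm Hn) ler_pXn2r ?nnegrE.
by split=> -[bL h]; split => // x; have := h x; rewrite E.
Qed.

Lemma unitary_isometry U : unitary_op dot U -> forall x, sq (U x) = sq x.
Proof.
move=> [bU UU _] x; apply: (@complexI R); rewrite !sqE (adjointP Hn eb) //.
by rewrite -[adjoint dot U (U x)]/((adjoint dot U \o U) x) UU.
Qed.

(** Yields convergence of the real sequence and the value of [limn] at once, as needed to recognize
    [mxact]. *)
Lemma vanishes_real_limit (z : C) (r : R^nat) : vanishes (fun n => csq (z - (r n)%:C%C)) ->
  z = (limn r)%:C%C.
Proof.
case: z => a b v.
have b0 : b = 0.
  apply/eqP; rewrite -sqrf_eq0 eq_le sqr_ge0 andbT; apply: vanishes_const.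
  by apply: vanishes_le v => n; rewrite /csq /= subr0 lerDr sqr_ge0.
suff : r @ \oo --> a by move=> /cvg_lim ->; rewrite ?b0.
apply/cvgrPdist_le => d d0; have [N hN] := v _ (exprn_gt0 2 d0).
exists N => // n /hN; rewrite /csq /= b0 subr0 expr0n addr0.
by rewrite -(real_normK (num_real _)) ler_pXn2r ?nnegrE // ltW.
Qed.

Lemma entry_conj_diag L eta i : bounded_op L -> c0star eta ->
  entry dot e (L \o diag_seq dot e eta \o adjoint dot L) i i =
  (mxact (sqmx L) eta i)%:C%C.
Proof.
move=> bL ec; rewrite /entry /= (adjointP Hn eb) //; set v := adjoint dot L (e i).
apply: vanishes_real_limit.
have w := synth_dot Hn v es (square_summable_scaled v (sqr_ge0 _) es (fun n => c0star_csq n ec)).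
apply: vanishes_le w => n; rewrite le_eqVlt; apply/orP; left; apply/eqP.
congr (csq (_ - _)); rewrite /series /= rmorph_sum /=; apply: eq_bigr => k _.
by rewrite rmorphM /= sqmx_adjoint // csq_conjE -/v -dotC mulrC mulrA.
Qed.

Lemma diag_part_coef A x i : bounded_op A ->
  dot (diag_part dot e A x) (e i) = entry dot e A i i * dot x (e i).
Proof.
move=> /bounded_opP -/(_ _ Hn) [_ [K K0 AK]].
apply: (schmidt_coef Hn eb x i K0 _ es) => n.
apply: le_trans (cauchy_schwarz _ _ _) _; rewrite sq_basis mulr1.
by apply: le_trans (AK _) _; rewrite sq_basis mulr1.
Qed.

Lemma diag_conj_iff L eta xi : bounded_op L -> c0star eta -> c0star xi ->
  diag_seq dot e xi = diag_part dot e (L \o diag_seq dot e eta \o adjoint dot L) <->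
  xi = mxact (sqmx L) eta.
Proof.
move=> bL ec xc.
have bA : bounded_op (L \o diag_seq dot e eta \o adjoint dot L).
  apply: (bounded_op_comp Hn); last exact: (adjoint_bounded Hn eb).
  by apply: (bounded_op_comp Hn) => //; exact: (diag_seq_bounded Hn eb).
split=> [h|->].
  apply/funext => i; have /(congr1 (fun T => dot (T (e i)) (e i))) := h.
  rewrite (diag_seq_coef Hn eb) // diag_part_coef // eo eqxx !mulr1.
  by rewrite entry_conj_diag // => /complexI.
rewrite /diag_part /diag_seq; congr (diag_op dot e _).
by apply/funext => n; rewrite entry_conj_diag.
Qed.

Lemma sq_entry_real U : (forall i j, entry dot e U i j \is Num.real) ->
  forall i j, (sqmx U i j)%:C%C = entry dot e U i j ^+ 2.
Proof.
by move=> Ur i j; rewrite /sqmx csq_conjE (conj_Creal (Ur i j)) expr2.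
Qed.

(* f_j and r_i are the j-th column and the i-th row of the matrix w. *)
Lemma orthogonal_of_rows_columns (w : nat -> nat -> R) (f r : nat -> H) :
  orthonormal_seq dot f -> orthonormal_seq dot r ->
  (forall i j, dot (f j) (e i) = (w i j)%:C%C) ->
  (forall i j, dot (r i) (e j) = (w i j)%:C%C) ->
  exists U, orthogonal_op dot e U /\ forall i j, entry dot e U i j = (w i j)%:C%C.
Proof.
move=> fo ro fw rw.
have fs := orthonormal_suborthonormal fo; have rs := orthonormal_suborthonormal ro.
have c1 (n : nat) : csq (1 : C) <= 1 by rewrite /csq /= expr1n expr0n addr0.
have c1' (n : nat) : csq ((1 : C)^*) <= 1 by rewrite csq_conj c1.
pose S g h := schmidt dot (fun=> 1) g h.
have Sadj g h : suborthonormal dot g -> suborthonormal dot h ->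
    forall x y, dot (S g h x) y = dot x (S h g y).
  move=> gs hs x y; rewrite /S (schmidt_adjoint Hn ler01 c1) //.
  by rewrite conjC1.
have Scoef g h : orthonormal_seq dot g -> suborthonormal dot h ->
    forall x i, dot (S g h x) (g i) = dot x (h i).
  move=> go hs x i; rewrite /S /schmidt.
  by rewrite (synth_coef Hn i go (square_summable_scaled x ler01 hs c1)) mul1r.
(* The operator assembled from the columns is the one assembled from the rows. An isometry need not
   be onto in infinite dimension: U U^* = 1 comes from the orthonormal rows through this
   identity. *)
have rowcol : forall x, S f e x = S e r x.
  move=> x; apply: (basis_ext eb) => i; rewrite Scoef // Sadj //.
  congr (dot x _); apply: (basis_ext eb) => k.
  by rewrite Scoef // dotC fw conjC_realC rw.
have adjS : adjoint dot (S f e) = S e f by apply: adjoint_uniq; exact: Sadj.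
have bU : bounded_op (S f e) by exact: (schmidt_bounded Hn ler01 c1).
exists (S f e); have en i j : entry dot e (S f e) i j = (w i j)%:C%C.
  by rewrite /entry rowcol Scoef // dotC rw conjC_realC.
split=> //; split; last by move=> i j; rewrite en; apply/complex_realP; exists (w i j).
split=> //; rewrite adjS; apply/funext => x /=; apply: (basis_ext eb) => i.
  by rewrite Scoef // Scoef.
rewrite rowcol Scoef // dotC -(Sadj _ _ fs es) rowcol -dotC.
have -> : S e r (r i) = e i by apply: (basis_ext eb) => k; rewrite Scoef // ro eo.
by [].
Qed.

Lemma orthogonal_op_contraction U : orthogonal_op dot e U -> contraction_op U.
Proof.
move=> [uU _]; apply/contraction_opP; split; first by case: uU.
by move=> x; rewrite unitary_isometry.
Qed.

End OperatorMatrices.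

(** * Splitting the indices into consecutive finite blocks *)

Section Blocks.
Variables (R : realType) (m : nat -> nat).
Hypothesis m0 : forall k, (0 < m k)%N.

(** Convertible to the local [off] of [block_orthogonal_op]. *)
Definition offset k := (\sum_(l < k) m l)%N.

Lemma offsetS k : offset k.+1 = (offset k + m k)%N.
Proof. by rewrite /offset big_ord_recr. Qed.

Lemma offset_le k l : (k <= l)%N -> (offset k <= offset l)%N.
Proof.
move=> /subnKC <-; elim: (l - k)%N => [|i IH]; first by rewrite addn0.
by rewrite addnS offsetS (leq_trans IH) // leq_addr.
Qed.

Lemma leq_offset k : (k <= offset k)%N.
Proof.
by elim: k => // k IH; rewrite offsetS -addn1 leq_add.
Qed.

Lemma block_decode i : exists k a, (a < m k)%N /\ i = (offset k + a)%N.
Proof.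
have [k] : exists k, (i < offset k)%N by exists i.+1; exact: leq_offset.
elim: k => [|k IH]; first by rewrite /offset big_ord0.
have [ik _|ki] := ltnP i (offset k); first exact: IH.
rewrite offsetS => h; exists k, (i - offset k)%N; lia.
Qed.

Lemma block_uniq k l a b : (a < m k)%N -> (b < m l)%N ->
  (offset k + a = offset l + b)%N -> k = l /\ a = b.
Proof.
have aux k' l' a' b' : (a' < m k')%N -> (k' < l')%N -> (offset k' + a' < offset l' + b')%N.
  move=> h kl; apply: (@leq_trans (offset k'.+1)); first by rewrite offsetS ltn_add2l.
  by apply: leq_trans (offset_le kl) _; exact: leq_addr.
move=> ak bl E; case: (ltngtP k l) => [kl|lk|kl].
- by have := aux _ _ _ b ak kl; rewrite E ltnn.
- by have := aux _ _ _ a bl lk; rewrite E ltnn.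
by split => //; move: E; rewrite kl => /addnI.
Qed.

Lemma series_block (g : R^nat) l :
  (forall k a, (k < l)%N -> (a < m k)%N -> g (offset k + a)%N = 0) ->
  series g (offset l.+1) = \sum_(a < m l) g (offset l + a)%N.
Proof.
move=> g0; rewrite offsetS /series /= (@big_cat_nat _ _ _ (offset l) 0) ?leq_addr //=.
rewrite big_nat_cond big1 ?add0r; last first.
  move=> i /andP[/andP[_ il] _]; have [k [a [ak iE]]] := block_decode i.
  rewrite iE g0 // ltnNge; apply/negP => lk; have := offset_le lk; lia.
by rewrite -{1}[offset l]add0n big_addn addKn big_mkord; apply: eq_bigr => a _; rewrite addnC.
Qed.

Lemma series_block_le (g : R^nat) l n : (forall i, 0 <= g i) ->
  (forall k a, k != l -> (a < m k)%N -> g (offset k + a)%N = 0) ->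
  series g n <= \sum_(a < m l) g (offset l + a)%N.
Proof.
move=> gp g0; rewrite -series_block; last by move=> k a kl; apply: g0; rewrite ltn_eqF.
apply: series_finite_support => // j lj; have [k [a [ak jE]]] := block_decode j.
rewrite jE g0 //; apply: contraTneq lj => kl; rewrite jE kl offsetS -ltnNge.
by rewrite ltn_add2l -kl.
Qed.

Lemma series_block_lim (g : R^nat) l :
  (forall k a, k != l -> (a < m k)%N -> g (offset k + a)%N = 0) ->
  limn (series g) = \sum_(a < m l) g (offset l + a)%N.
Proof.
move=> g0; rewrite -series_block; last by move=> k a kl; apply: g0; rewrite ltn_eqF.
apply: lim_near_cst => //; near=> n.
have : (offset l.+1 <= n)%N by near: n; exact: nbhs_infty_ge.
move=> /subnKC <-; elim: (n - _)%N => [|i IH]; first by rewrite addn0.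
rewrite addnS seriesSr IH [X in _ + X](_ : _ = 0) ?addr0 //.
have [k [a [ak jE]]] := block_decode (offset l.+1 + i)%N.
rewrite jE g0 //; apply/eqP => kl; move: jE; rewrite kl offsetS in ak *; lia.
Unshelve. all: by end_near. Qed.

(** Blocks take natural numbers as indices, so decoded positions can be compared without casts
    between ordinal types of different sizes. *)
Lemma block_matrix_exists (B : nat -> nat -> nat -> R) : exists w : nat -> nat -> R,
  (forall k a b, (a < m k)%N -> (b < m k)%N ->
     w (offset k + a)%N (offset k + b)%N = B k a b) /\
  forall k l a b, k != l -> (a < m k)%N -> (b < m l)%N ->
     w (offset k + a)%N (offset l + b)%N = 0.
Proof.
have [dec hdec] := @choice _ _ (fun i (p : nat * nat) => (p.2 < m p.1)%N /\ i = (offset p.1 + p.2)%N)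
  (fun i => let: ex_intro k (ex_intro a h) := block_decode i in ex_intro _ (k, a) h).
have decE k a : (a < m k)%N -> dec (offset k + a)%N = (k, a).
  move=> ak; have [h1 h2] := hdec (offset k + a)%N.
  have [h3 h4] := block_uniq ak h1 h2.
  by rewrite [LHS]surjective_pairing -h3 -h4.
exists (fun i j => if (dec i).1 == (dec j).1 then B (dec i).1 (dec i).2 (dec j).2 else 0).
split=> [k a b ak bk|k l a b kl ak bl]; first by rewrite !decE // eqxx.
by rewrite !decE //= (negPf kl).
Qed.

End Blocks.

(** * Operators with prescribed finite orthogonal blocks *)

Section BlockOperators.
Variables (R : realType) (H : completeNormedModType R[i]).
Variable dot : {dot H for Num.conj}.
Hypothesis Hn : hilbert_norm dot.
Local Notation C := R[i].
Variable e : nat -> H.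
Hypothesis eb : orthonormal_basis dot e.
Let eo : orthonormal_seq dot e. Proof. by case: eb. Qed.

(** Each column is a finite combination of basis vectors, cut at the end of its block, so no
    convergence is involved. Used for a matrix and for its transpose. *)
Lemma block_columns (m : nat -> nat) (m0 : forall k, (0 < m k)%N) (w : nat -> nat -> R) :
  (forall k l a b, k != l -> (a < m k)%N -> (b < m l)%N ->
     w (offset m k + a)%N (offset m l + b)%N = 0) ->
  (forall l b b', (b < m l)%N -> (b' < m l)%N ->
     \sum_(a < m l) w (offset m l + a)%N (offset m l + b)%N *
        w (offset m l + a)%N (offset m l + b')%N = (b == b')%:R) ->
  exists2 f : nat -> H, orthonormal_seq dot f &
    forall i j, dot (f j) (e i) = (w i j)%:C%C.
Proof.
move=> woff wblk.
have [blk hblk] : exists blk : nat -> nat, forall j, exists2 b, (b < m (blk j))%N &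
    j = (offset m (blk j) + b)%N.
  have [blk hblk] := @choice _ _ (fun j k => exists2 b, (b < m k)%N & j = (offset m k + b)%N)
    (fun j => let: ex_intro k (ex_intro b (conj h1 h2)) := block_decode m0 j in
       ex_intro _ k (ex_intro2 _ _ b h1 h2)).
  by exists blk.
pose f j := series (fun i => (w i j)%:C%C *: e i) (offset m (blk j).+1).
have fw i j : dot (f j) (e i) = (w i j)%:C%C.
  rewrite /f dot_sum_l.
  have [ij|ji] := ltnP i (offset m (blk j).+1).
    rewrite (bigD1_seq i) ?iota_uniq ?mem_index_iota //= eo eqxx mulr1 big1 ?addr0 //.
    by move=> k /negPf ki; rewrite eo ki mulr0.
  rewrite big_nat_cond big1; last first.
    move=> k /andP[/andP[_ kj] _]; rewrite eo ltn_eqF ?mulr0 //.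
    exact: leq_trans kj ji.
  have [b bm jE] := hblk j; have [k [a [ak iE]]] := block_decode m0 i.
  rewrite {1}jE iE woff //; apply: contraTneq ji => kj.
  by rewrite -ltnNge iE kj offsetS ltn_add2l -kj.
exists f => // j j'; rewrite {1}/f dot_sum_l.
transitivity ((series (fun i => w i j * w i j') (offset m (blk j).+1))%:C%C).
  rewrite /series /= rmorph_sum /=; apply: eq_bigr => i _.
  by rewrite dotC fw conjC_realC rmorphM.
have [b bm jE] := hblk j; have [b' bm' jE'] := hblk j'.
move: (blk j) (blk j') bm jE bm' jE' => k k' bm -> bm' ->.
rewrite (series_block m0); last first.
  by move=> l a lk al; rewrite woff ?mul0r // ltn_eqF.
have [E|nE] := eqVneq k k'.
  by rewrite -E in bm' *; rewrite wblk // eqn_add2l; case: (b == b').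
rewrite big1 => [|a _]; last by rewrite [X in _ * X]woff ?mulr0.
case: eqP => // E; have [kk _] := block_uniq bm bm' E.
by rewrite kk eqxx in nE.
Qed.

Lemma block_unitary_exists (m : nat -> nat) (m0 : forall k, (0 < m k)%N)
    (B : forall k, 'M[R]_(m k)) : (forall k, B k *m (B k)^T = 1%:M) ->
  exists U, [/\ orthogonal_op dot e U, block_orthogonal_op dot e U,
    forall k (a b : 'I_(m k)),
      entry dot e U (offset m k + a) (offset m k + b) = (B k a b)%:C%C &
    forall k l (a : 'I_(m k)) (b : 'I_(m l)), k != l ->
      entry dot e U (offset m k + a) (offset m l + b) = 0].
Proof.
move=> BB.
pose Bn k a b := if insub a is Some a' then
  (if insub b is Some b' then B k a' b' else 0) else 0 : R.
have BnE k (a b : 'I_(m k)) : Bn k a b = B k a b by rewrite /Bn !valK.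
have [w [won woff]] := block_matrix_exists m0 Bn.
have won' k (a b : 'I_(m k)) : w (offset m k + a)%N (offset m k + b)%N = B k a b.
  by rewrite won // BnE.
have [f fo fw] : exists2 f : nat -> H, orthonormal_seq dot f &
    forall i j, dot (f j) (e i) = (w i j)%:C%C.
  apply: (block_columns m0) => // l b b' bm bm'.
  transitivity (((B l)^T *m B l) (Ordinal bm) (Ordinal bm')).
    rewrite mxE; apply: eq_bigr => a _; rewrite !mxE.
    by rewrite -(won' l a (Ordinal bm)) -(won' l a (Ordinal bm')).
  (* For a finite square block, orthonormal rows imply orthonormal columns. *)
  by rewrite (mulmx1C (BB l)) mxE.
have [r ro rw] : exists2 r : nat -> H, orthonormal_seq dot r &
    forall i j, dot (r j) (e i) = (w j i)%:C%C.
  apply: (@block_columns _ m0 (fun i j => w j i)).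
    by move=> k l a b kl ak bl; apply: woff => //; rewrite eq_sym.
  move=> l b b' bm bm'.
  transitivity ((B l *m (B l)^T) (Ordinal bm) (Ordinal bm')).
    rewrite mxE; apply: eq_bigr => a _; rewrite !mxE.
    by rewrite -(won' l (Ordinal bm) a) -(won' l (Ordinal bm') a).
  by rewrite (BB l) mxE.
have [U [oU enU]] := orthogonal_of_rows_columns Hn eb fo ro fw (fun i j => rw j i).
have h1 k (a b : 'I_(m k)) :
    entry dot e U (offset m k + a) (offset m k + b) = (B k a b)%:C%C by rewrite enU won'.
have h2 k l (a : 'I_(m k)) (b : 'I_(m l)) : k != l ->
    entry dot e U (offset m k + a) (offset m l + b) = 0 by move=> kl; rewrite enU woff.
exists U; split => //; split; first by case: oU => -[].
by exists m, B.
Qed.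

(** [block_orthogonal_op] asserts only boundedness and the block form, so the bounds on the sums are
    read off the blocks: rows from B B^T = 1, columns from B^T B = 1. *)
Lemma block_orthogonal_real U : block_orthogonal_op dot e U ->
  (forall i j, entry dot e U i j \is Num.real) /\ substochastic (sqmx dot e U).
Proof.
move=> [bU [m [B [m0 BB on off]]]].
rewrite -/(offset m) in on off.
have U0 i j : 0 <= sqmx dot e U i j by apply: csq_ge0.
split.
  move=> i j; have [k [a [ak ->]]] := block_decode m0 i; have [l [b [bl ->]]] := block_decode m0 j.
  have [kl|kl] := eqVneq k l; last by rewrite (off k l (Ordinal ak) (Ordinal bl) kl).
  rewrite -kl in bl *.
  by rewrite (on k (Ordinal ak) (Ordinal bl)); apply/complex_realP; eexists.
have sqon k (a b : 'I_(m k)) : sqmx dot e U (offset m k + a) (offset m k + b) = B k a b ^+ 2.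
  by rewrite /sqmx on csq_real.
split=> // i; apply/(eneseries_le1 _) => // n; have [k [a [ak iE]]] := block_decode m0 i.
  apply: le_trans (series_block_le m0 (l := k) n _ _) _ => //.
    by move=> l b lk bl; rewrite iE /sqmx (off k l (Ordinal ak) (Ordinal bl)) ?csq0 // eq_sym.
  have /matrixP/(_ (Ordinal ak) (Ordinal ak)) := BB k; rewrite !mxE eqxx => h.
  rewrite -[leRHS]/(true%:R) -h.
  rewrite le_eqVlt; apply/orP; left; apply/eqP; apply: eq_bigr => b _.
  by rewrite iE (sqon k (Ordinal ak) b) mxE expr2.
apply: le_trans (series_block_le m0 (l := k) n _ _) _ => //.
  by move=> l b lk bl; rewrite iE /sqmx (off l k (Ordinal bl) (Ordinal ak)) ?csq0.
have /matrixP/(_ (Ordinal ak) (Ordinal ak)) := mulmx1C (BB k); rewrite !mxE eqxx => h.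
rewrite -[leRHS]/(true%:R) -h.
rewrite le_eqVlt; apply/orP; left; apply/eqP; apply: eq_bigr => b _.
by rewrite iE (sqon k b (Ordinal ak)) mxE expr2.
Qed.

End BlockOperators.

(** * Realizing a majorization by orthogonal operators *)

Section Realization.
Variables (R : realType) (H : completeNormedModType R[i]).
Variable dot : {dot H for Num.conj}.
Hypothesis Hn : hilbert_norm dot.
Local Notation C := R[i].
Local Notation sq := (sq dot).
Variable e : nat -> H.
Hypothesis eb : orthonormal_basis dot e.
Let eo : orthonormal_seq dot e. Proof. by case: eb. Qed.
Implicit Types (xi eta : R^nat) (I : set (H -> H)).

Lemma block_majorized_refl xi : block_majorized xi xi.
Proof. by split=> [n|]; [exact: lexx | exists id; split]. Qed.

Lemma block_majorized_unitary xi eta : c0star xi -> c0star eta -> block_majorized xi eta ->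
  exists U, [/\ orthogonal_op dot e U, block_orthogonal_op dot e U &
    xi = mxact (sqmx dot e U) eta].
Proof.
move=> xc ec [maj [n [nmono ne]]]; have [_ xd _] := xc.
(* Block boundaries. The index n 0 may be 0 and would give an empty block, so 0 takes its place. *)
pose t k := if k is k'.+1 then n k'.+1 else 0%N.
have tS k : (t k < t k.+1)%N.
  case: k => [|k] /=; last by apply: nmono.
  by apply: leq_ltn_trans (leq0n (n 0%N)) (nmono _ _ _).
pose m k := (t k.+1 - t k)%N.
have m0 k : (0 < m k)%N by rewrite subn_gt0.
have tE k : offset m k = t k.
  elim: k => [|k IH]; first by rewrite /offset big_ord0.
  by rewrite offsetS IH /m subnKC // ltnW.
have teq k : series xi (t k) = series eta (t k).
  by case: k => [|k] /=; rewrite ?series0n // ne.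
(* The partial sums of [xi] and [eta] agree at the start of a block, so majorization restricts to
   each block. *)
have prefix (g : R^nat) k j : (j <= m k)%N ->
    \sum_(l < m k | (l < j)%N) g (offset m k + l)%N = series g (t k + j)%N - series g (t k).
  move=> jm; rewrite -(big_ord_widen_cond (m k) xpredT (fun l => g (offset m k + l)%N) jm) /=.
  rewrite tE; elim: j {jm} => [|j IH]; first by rewrite big_ord0 addn0 subrr.
  by rewrite big_ord_recr /= IH addnS seriesSr addrAC.
have [B hB] : exists B : forall k, 'M[R]_(m k), forall k, B k *m (B k)^T = 1%:M /\
    forall a, conj_diag (B k) (fun b => eta (offset m k + b)%N) a = xi (offset m k + a)%N.
  suff h k : {V : 'M[R]_(m k) | V *m V^T = 1%:M /\
      forall a, conj_diag V (fun b => eta (offset m k + b)%N) a = xi (offset m k + a)%N}.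
    by exists (fun k => projT1 (h k)) => k; exact: projT2 (h k).
  apply: cid; apply: (horn (x := fun a : 'I_(m k) => xi (offset m k + a)%N)).
  - by move=> a b ab; apply: xd; rewrite leq_add2l.
  - move=> j; have [jm|/ltnW mj] := leqP j (m k).
      by rewrite !prefix // teq lerB.
    have full (g : R^nat) : \sum_(l < m k | (l < j)%N) g (offset m k + l)%N =
        \sum_(l < m k | (l < m k)%N) g (offset m k + l)%N.
      by apply: eq_bigl => l; rewrite ltn_ord (leq_trans (ltn_ord l) mj).
    by rewrite !full !prefix // teq lerB.
  - have full (g : R^nat) : \sum_(l < m k) g (offset m k + l)%N =
        \sum_(l < m k | (l < m k)%N) g (offset m k + l)%N.
      by apply: eq_bigl => l; rewrite ltn_ord.
    by rewrite !full !prefix // teq /m subnKC ?teq // ltnW.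
have [U [oU bU on off]] := block_unitary_exists Hn eb m0 (fun k => proj1 (hB k)).
exists U; split => //; apply/funext => i.
have [k [a [ak ->]]] := block_decode m0 i.
rewrite /mxact (series_block_lim m0 (l := k)); last first.
  by move=> l b lk bl; rewrite /sqmx (off k l (Ordinal ak) (Ordinal bl)) ?csq0 ?mul0r // eq_sym.
rewrite -(proj2 (hB k) (Ordinal ak)); apply: eq_bigr => b _.
by rewrite /sqmx (on k (Ordinal ak) b) csq_real.
Qed.

(* The reflection mapping e_0 to the unit vector with coordinates sqrt (xi_i / S). *)
Lemma summable_unitary xi (S : R) : c0star xi -> 0 < S -> series xi @ \oo --> S ->
  exists U, orthogonal_op dot e U /\
    xi = mxact (sqmx dot e U) (fun n => if n == 0%N then S else 0).
Proof.
move=> [x0 xd xl] S0 xS.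
pose c n := Num.sqrt (xi n / S).
have c2 n : c n ^+ 2 = xi n / S by rewrite sqr_sqrtr // divr_ge0 // ltW.
have cS : series (fun n => csq (c n)%:C%C) @ \oo --> (1 : R).
  rewrite (_ : series _ = fun n => series xi n / S).
    by rewrite -(divff (lt0r_neq0 S0)); apply: cvgM => //; exact: cvg_cst.
  apply/funext => n; rewrite /series /= mulr_suml; apply: eq_bigr => k _.
  by rewrite csq_real c2.
have css : square_summable (fun n => (c n)%:C%C : C) 1.
  move=> n; rewrite -(cvg_lim _ cS) //; apply: nondecreasing_cvgn_le; last exact: cvgP cS.
  by apply/nondecreasing_seqP => k; rewrite seriesSr lerDl csq_ge0.
pose u := synth e (fun n => (c n)%:C%C : C).
have uc n : dot u (e n) = (c n)%:C%C by apply: (synth_coef Hn n eo css).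
have su : sq u = 1.
  have p := parseval Hn eb (x:=u).
  rewrite -(cvg_lim _ p) // -(cvg_lim _ cS) //; congr (limn (series _)).
  by apply/funext => n; rewrite uc.
pose v := u - e 0%N.
pose vr n : R := c n - (n == 0%N)%:R.
have vc n : dot v (e n) = (vr n)%:C%C.
  rewrite /v linearBl /= uc eo /vr rmorphB /= eq_sym; congr (_ - _).
  by case: (n == 0%N).
have sv : (sq v)%:C%C = (2 - 2 * c 0%N)%:C%C.
  rewrite sqE /v dnormB -!sqE su (sq_basis eb) uc conjC_realC -!rmorphD -rmorphB /=.
  by congr (_%:C%C); ring.
have {}sv : sq v = 2 - 2 * c 0%N by apply: complexI sv.
(* The reflection is 1 - k v v^*. If u = e_0 then v = 0 and k = 0 by the convention on inverses, and
   the reflection is the identity. *)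
pose k : R := 2 / sq v.
have kE i j : k * (k * sq v) * vr i * vr j = 2 * k * vr i * vr j.
  have [v0|vn0] := eqVneq (sq v) 0.
    by rewrite /k v0 invr0 !mulr0 !mul0r.
  by rewrite {2}/k divfK //; ring.
pose w i j : R := (i == j)%:R - k * vr j * vr i.
pose f j := e j - (k * vr j)%:C%C *: v.
have realB (b : bool) : (b%:R : C) = (b%:R : R)%:C%C by case: b.
have fw i j : dot (f j) (e i) = (w i j)%:C%C.
  by rewrite /f linearBl /= dotZl eo vc -rmorphM /= eq_sym realB -rmorphB.
have fo : orthonormal_seq dot f.
  move=> i j; rewrite {2}/f linearBr /= fw dotZr conjC_realC.
  have -> : dot (f i) v = (vr i - k * vr i * sq v)%:C%C.
    by rewrite /f linearBl /= dotZl -sqE dotC vc conjC_realC -rmorphM -rmorphB.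
  rewrite -rmorphM -rmorphB realB; congr (_%:C%C); rewrite /w eq_sym.
  apply/eqP; rewrite -subr_eq0; apply/eqP.
  transitivity (k * (k * sq v) * vr i * vr j - 2 * k * vr i * vr j); first by ring.
  by rewrite kE subrr.
(* A real reflection is symmetric, so its columns also serve as its rows. *)
have wsym i j : w i j = w j i by rewrite /w eq_sym; ring.
have [U [oU en]] := orthogonal_of_rows_columns Hn eb fo fo fw
  (fun i j => etrans (fw j i) (congr1 (fun r => r%:C%C) (wsym j i))).
exists U; split => //; apply/funext => i.
have wi0 : w i 0%N = c i.
  rewrite /w; have [v0|vn0] := eqVneq (sq v) 0.
    have : vr i = 0 by apply: (@complexI R); rewrite -vc (sq_eq0 v0) linear0l.
    by move=> h; rewrite h mulr0 subr0; move/eqP: h; rewrite subr_eq0 => /eqP.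
  (* Here v_0 = c_0 - 1 and |v|^2 = 2 - 2 c_0; hence column 0 of w consists of the coordinates of
     u. *)
  have -> : k * vr 0%N = -1.
    rewrite /k /vr /=; apply: (mulIf vn0); rewrite mulrAC divfK // sv; ring.
  by rewrite mulN1r opprK /vr addrC subrK.
rewrite /mxact; apply/esym; apply: lim_near_cst => //; near=> n.
have : (1 <= n)%N by near: n; exact: nbhs_infty_ge.
move=> /prednK <-; rewrite /series /= big_nat_recl //= big1 ?addr0.
  by rewrite /sqmx en wi0 csq_real c2 divfK // lt0r_neq0.
by move=> j _; rewrite mulr0.
Unshelve. all: by end_near. Qed.

Lemma am_closure_majorized I xi : operator_ideal I -> c0star xi ->
  charset dot (am_closure dot I) xi <->
  exists2 eta, charset dot I eta & majorized xi eta.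
Proof.
move=> Iid xc; rewrite /am_closure /pre_am_ideal /am_ideal.
rewrite (charset_of_charset Hn eb) /=; last by move=> s [].
rewrite (charset_of_charset Hn eb) /=; last by move=> s [].
split=> [[_ [_ [eta Ie O]]]|[eta Ie maj]].
  have [k k0 maj] := mean_bigO_majorized O.
  exists (fun n => k * eta n) => //.
  apply: (charset_hereditary Hn eb Iid _ Ie (K := k)) => //.
  by apply: c0starZ (ltW k0) _; case: Ie => X _ [].
split=> //; split; first exact: arithmetic_mean_c0star.
exists eta => //; exists 1 => // n; rewrite mul1r.
by move: n; apply/majorized_arithmetic_mean.
Qed.

Lemma majorized_realization I xi eta : operator_ideal I -> c0star xi ->
  charset dot I eta -> majorized xi eta ->
  exists2 zeta, charset dot I zeta & strongly_majorized xi zeta /\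
    exists2 U, orthogonal_op dot e U & xi = mxact (sqmx dot e U) zeta.
Proof.
move=> Iid xc Ie maj; have [x0 xd xl] := xc.
have ec : c0star eta by case: Ie => X _ [].
have block zeta : charset dot I zeta -> block_majorized xi zeta ->
    exists2 zeta, charset dot I zeta & strongly_majorized xi zeta /\
      exists2 U, orthogonal_op dot e U & xi = mxact (sqmx dot e U) zeta.
  move=> Iz bm; have zc : c0star zeta by case: Iz => X _ [].
  exists zeta => //; split; first exact: block_strongly_majorized.
  by have [U [oU _ E]] := block_majorized_unitary xc zc bm; exists U.
have [xS|xnS] := pselect (cvgn (series xi)); last first.
  have [zeta [zc ze bm]] := block_majorized_below x0 xnS ec maj.
  by apply: block bm; exact: (charset_hereditary Hn eb Iid zc Ie ze).
pose S := limn (series xi).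
have Sle n : series xi n <= S.
  apply: nondecreasing_cvgn_le => //.
  by apply/nondecreasing_seqP => k; rewrite seriesSr lerDl.
(* If S is not positive then [xi] = 0, which is dominated by 0 times [eta] and serves as its own
   witness; the reflection would divide by S. *)
have [S0|Sp] := leP S 0.
  have xz n : xi n <= 0 * eta n.
    rewrite mul0r; apply: le_trans S0; apply: le_trans (Sle n.+1).
    by rewrite seriesSr lerDr series_ge0.
  apply: (block xi); first exact: (charset_hereditary Hn eb Iid xc Ie xz).
  exact: block_majorized_refl.
(* Positivity of eta 0 places (S, 0, 0, ...) in Sigma(I), with constant S / eta 0. *)
have e0 : 0 < eta 0%N.
  rewrite lt_neqAle; apply/andP; split; last by case: ec.
  apply: contraTneq Sp => e0; rewrite -leNgt; apply: limr_le => //; near=> n.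
  have x00 : xi 0%N <= 0 by have := maj 1%N; rewrite !seriesSr !series0n !add0r e0.
  rewrite /series /= big1 // => k _; apply/eqP; rewrite eq_le x0 andbT.
  by apply: le_trans x00; apply: xd.
pose zeta : R^nat := fun n => if n == 0%N then S else 0.
have z0 n : 0 <= zeta n by rewrite /zeta; case: ifP => // _; exact: ltW.
have zS n : series zeta n.+1 = S.
  by rewrite /series /= big_nat_recl //= big1 ?addr0.
have zc : c0star zeta.
  split => //.
    by apply/nonincreasing_seqP => n; exact: z0.
  apply: cvg_near_cst; near=> n.
  have : (1 <= n)%N by near: n; exact: nbhs_infty_ge.
  by move=> /prednK <-.
have ze n : zeta n <= (S / eta 0%N) * eta n.
  rewrite /zeta; case: n => [|n] /=; first by rewrite divfK // lt0r_neq0.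
  by apply: mulr_ge0; [apply: divr_ge0; exact: ltW | case: ec].
exists zeta; first exact: (charset_hereditary Hn eb Iid zc Ie ze).
split; last by have [U [oU E]] := summable_unitary xc Sp xS; exists U.
apply: sum_strongly_majorized.
  by case=> [|n]; rewrite ?series0n // zS.
rewrite -(subrr S); apply: cvgB => //; apply: cvg_near_cst; near=> n.
have : (1 <= n)%N by near: n; exact: nbhs_infty_ge.
by move=> /prednK <-; rewrite zS.
Unshelve. all: by end_near. Qed.

(** A summable [xi] belongs to Sigma(I) through the trace class and is its own witness; the sequence
    (S, 0, 0, ...) would meet the partial sums of [xi] infinitely often only for finitely supported
    [xi]. *)
Lemma majorized_block_realization I xi eta : operator_ideal I -> c0star xi ->
  trace_class dot `<=` I -> charset dot I eta -> majorized xi eta ->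
  exists2 zeta, charset dot I zeta & block_majorized xi zeta.
Proof.
move=> Iid xc L1 Ie maj; have [x0 xd xl] := xc.
have ec : c0star eta by case: Ie => X _ [].
have [xS|xnS] := pselect (cvgn (series xi)); last first.
  have [zeta [zc ze bm]] := block_majorized_below x0 xnS ec maj.
  by exists zeta => //; exact: (charset_hereditary Hn eb Iid zc Ie ze).
exists xi; last exact: block_majorized_refl.
apply/(charsetP Hn eb) => //; split=> //; apply: L1.
split; first exact: (diag_seq_compact Hn eb).
by exists xi => //; exact: (diag_seq_singular Hn eb).
Qed.

End Realization.

Theorem theorem8p1 (R : realType) (H : completeNormedModType R[i])
    (dot : {dot H for Num.conj}) (e : nat -> H) (I : set (H -> H)) (xi : R^nat) :
  hilbert_norm dot -> orthonormal_basis dot e ->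
  operator_ideal I -> c0star xi ->
  [<-> (* i *) charset dot (am_closure dot I) xi;
       (* ii *) exists2 eta, charset dot I eta & majorized xi eta;
       (* ii' *) exists2 eta, charset dot I eta & strongly_majorized xi eta;
       (* iii *) exists2 eta, charset dot I eta &
         exists2 P, substochastic P & xi = mxact P eta;
       (* iii' *) exists2 eta, charset dot I eta &
         exists2 Q, orthostochastic dot e Q & xi = mxact Q eta;
       (* iv *) exists2 eta, charset dot I eta &
         exists2 L, contraction_op L &
           diag_seq dot e xi =
           diag_part dot e (L \o diag_seq dot e eta \o adjoint dot L);
       (* iv' *) exists2 eta, charset dot I eta &
         exists2 U, orthogonal_op dot e U &
           diag_seq dot e xi =
           diag_part dot e (U \o diag_seq dot e eta \o adjoint dot U)]
  /\
  (trace_class dot `<=` I ->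
   [<-> (* i *) charset dot (am_closure dot I) xi;
        (* ii'' *) exists2 eta, charset dot I eta & block_majorized xi eta;
        (* iii'' *) exists2 eta, charset dot I eta &
          exists2 Q, block_orthostochastic dot e Q & xi = mxact Q eta;
        (* iv'' *) exists2 eta, charset dot I eta &
          exists2 U, block_orthogonal_op dot e U &
            diag_seq dot e xi =
            diag_part dot e (U \o diag_seq dot e eta \o adjoint dot U)]).
Proof.
move=> Hn eb Iid xc.
have charc eta : charset dot I eta -> c0star eta by case=> X _ [].
have am := am_closure_majorized Hn eb Iid xc.
have real eta : charset dot I eta -> majorized xi eta ->
    exists2 zeta, charset dot I zeta & strongly_majorized xi zeta /\
      exists2 U, orthogonal_op dot e U & xi = mxact (sqmx dot e U) zeta.
  exact: (majorized_realization Hn eb Iid xc).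
have sub eta P : charset dot I eta -> substochastic P -> xi = mxact P eta ->
    majorized xi eta.
  by move=> /charc ec Ps ->; exact: substochastic_majorized.
have sqmxE (Q : nat -> nat -> R) U : (forall i j, entry dot e U i j \is Num.real) ->
    (forall i j, (Q i j)%:C%C = entry dot e U i j ^+ 2) -> Q = sqmx dot e U.
  move=> Ur QU; apply/funext => i; apply/funext => j; apply: (@complexI R).
  by rewrite (sq_entry_real Ur) QU.
have contr eta L : charset dot I eta -> contraction_op L ->
    diag_seq dot e xi = diag_part dot e (L \o diag_seq dot e eta \o adjoint dot L) ->
    majorized xi eta.
  move=> Ie /(contraction_opP Hn) [bL L1] /(diag_conj_iff Hn eb bL (charc _ Ie) xc).
  by apply: (sub _ _ Ie); exact: (contraction_substochastic Hn eb).
split.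
  have orth : (exists2 eta, charset dot I eta & majorized xi eta) ->
      exists2 eta, charset dot I eta & exists2 U, orthogonal_op dot e U &
        xi = mxact (sqmx dot e U) eta.
    by move=> [eta Ie /(real _ Ie) [zeta Iz [_ h]]]; exists zeta.
  have orthQ : (exists2 eta, charset dot I eta & majorized xi eta) ->
      exists2 eta, charset dot I eta &
         exists2 Q, orthostochastic dot e Q & xi = mxact Q eta.
    move=> /orth [eta Ie [U oU E]]; exists eta => //; exists (sqmx dot e U) => //.
    by exists U => // i j; rewrite sq_entry_real //; case: oU.
  have orthU : (exists2 eta, charset dot I eta & majorized xi eta) ->
      exists2 eta, charset dot I eta & exists2 U, orthogonal_op dot e U &
           diag_seq dot e xi =
           diag_part dot e (U \o diag_seq dot e eta \o adjoint dot U).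
    move=> /orth [eta Ie [U oU E]]; exists eta => //; exists U => //.
    by apply/(diag_conj_iff Hn eb _ (charc _ Ie) xc) => //; case: oU => -[].
  (* The links into (iii), (iii') and (iv') return to majorization and choose a new [eta]; from
     (iii') to (iv) both [eta] and U are kept. *)
  tfae.
  - by move=> /am.
  - by move=> [eta Ie /(real _ Ie) [zeta Iz [h _]]]; exists zeta.
  - move=> [eta Ie [maj _]].
    have /orth [zeta Iz [U oU E]] : exists2 eta, charset dot I eta & majorized xi eta by exists eta.
    exists zeta => //; exists (sqmx dot e U) => //.
    by have /(contraction_opP Hn) [bU U1] := orthogonal_op_contraction Hn eb oU;
      exact: (contraction_substochastic Hn eb).
  - by move=> [eta Ie [P Ps E]]; apply: orthQ; exists eta => //; exact: sub E.
  - move=> [eta Ie [Q [U oU QU] E]]; exists eta => //; exists U.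
      exact: (orthogonal_op_contraction Hn eb oU).
    apply/(diag_conj_iff Hn eb _ (charc _ Ie) xc); first by case: oU => -[].
    by rewrite -(sqmxE Q) //; case: oU.
  - by move=> [eta Ie [L cL E]]; apply: orthU; exists eta => //; exact: contr E.
  - move=> [eta Ie [U oU E]]; apply/am; exists eta => //.
    by apply: (contr _ _ Ie _ E); exact: (orthogonal_op_contraction Hn eb oU).
move=> L1; tfae.
- by move=> /am [eta Ie maj]; exact: (majorized_block_realization Hn eb Iid xc L1 Ie maj).
- move=> [eta Ie bm]; exists eta => //.
  have [U [oU bU E]] := block_majorized_unitary Hn eb xc (charc _ Ie) bm.
  exists (sqmx dot e U) => //; exists U => // i j.
  by rewrite sq_entry_real //; case: oU.
- move=> [eta Ie [Q [U bU QU] E]]; exists eta => //; exists U => //.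
  apply/(diag_conj_iff Hn eb _ (charc _ Ie) xc); first by case: bU.
  by rewrite -(sqmxE Q) //; case: (block_orthogonal_real bU).
- move=> [eta Ie [U bU /(diag_conj_iff Hn eb (proj1 bU) (charc _ Ie) xc) E]].
  apply/am; exists eta => //; apply: (sub _ _ Ie _ E).
  by case: (block_orthogonal_real bU).
Qed.
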